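(* Consider the symmetric moment problem given by a sequence $(b_n)_{n\ge0}$ of positive numbers satisfying $$\frac{b_{n-1}}{b_n}\le e^{-f(n)},\qquad n\ge n_0,$$ where $f(n)>0$ for $n\ge n_0$, and put $\alpha:=\liminf_{n\to\infty} nf(n)\in[0,\infty]$. Then (i) $\limsup_{n\to\infty} U_n^{1/n}\le e^{2u(\alpha)}$ for $0\le\alpha\le\infty$; (ii) $\limsup_{n\to\infty} V_n^{1/n}\le e^{v(\alpha)/2}$ for $1\le\alpha\le\infty$; (iii) property (cs* ), i.e. $\sum_{l=0}^\infty c_l|s_{l+m}|<\infty$ for all $m\ge0$, holds if $k(\alpha)<1$, which in turn holds for $\alpha\ge 1.68746$.
   Context: Given positive numbers $(b_n)_{n\ge0}$, let $P_{-1}=0$, $P_0=1$ and $xP_n(x)=b_nP_{n+1}(x)+b_{n-1}P_{n-1}(x)$, $n\ge0$ (the value of $b_{-1}$ is irrelevant). There is a probability measure $\mu$ on $\mathbb{R}$ with infinite support and all moments for which $(P_n)$ are the orthonormal polynomials; its moments $s_n=\int x^n\,d\mu$ depend only on $(b_n)$ (and $s_n=0$ for $n$ odd). The associated Hamburger moment problem is the symmetric moment problem given by $(b_n)$; it is indeterminate if more than one measure has the moments $(s_n)$. Write $P_n(x)=\sum_{k=0}^n b_{k,n}x^k$. In the indeterminate case put $c_k=\big(\sum_{n=k}^\infty b_{k,n}^2\big)^{1/2}<\infty$. Define $U_0=s_0=1$, $V_0=c_0$ and for $n\ge1$ $$U_n=\frac{s_{2n}}{b_0^2b_1^2\cdots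 b_{n-1}^2},\qquad V_n=b_0b_1\cdots b_{n-1}\,c_n .$$ $U_n$ is defined for every moment problem; $c_n$ and $V_n$ are defined for indeterminate problems (under the hypotheses of the theorem with $\alpha>1$ the problem is indeterminate). The following decreasing functions are used: $$u(\alpha)=\max_{2^{-1/\alpha}\le x\le1}(x+1)\int_x^1\log\Big(\frac{y^\alpha}{1-y^\alpha}\Big)\frac{dy}{(1+y)^2},\quad \alpha>0,$$ $$v(\alpha)=\int_1^\infty\log\big([1-x^{-\alpha}]^{-1}\big)\,dx,\quad\alpha>1,\qquad k(\alpha)=4^{-\alpha}\exp(2u(\alpha)+v(\alpha)),\quad\alpha>1,$$ with limiting values $u(0)=\infty$, $u(\infty)=0$, $v(1)=\infty$, $v(\infty)=0$, $k(\infty)=0$ (and $e^{\infty}=\infty$). *)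

(* Defs.v *)
From HB Require Import structures.
From mathcomp Require Import all_boot all_order all_algebra.
From mathcomp Require Import all_classical all_reals all_analysis.
Set Implicit Arguments.
Unset Strict Implicit.
Unset Printing Implicit Defensive.
Import Order.TTheory GRing.Theory Num.Theory.
Import numFieldNormedType.Exports.
Local Open Scope classical_set_scope.
Local Open Scope ring_scope.

(* P_0 = 1 and b_m P_{m+1} = x P_m - b_{m-1} P_{m-1}, with P_{-1} = 0. *)
Fixpoint orthopoly (R : realType) (b : nat -> R) (n : nat) : {poly R} :=
  if n is m.+1 then
    (b m)^-1 *: ('X * orthopoly b m
                 - (if m is l.+1 then b l *: orthopoly b l else 0))
  else 1.

(* mu has moments of all orders and the polynomials P_n are orthonormal in
   L^2(mu), so mu is a solution of the moment problem given by b.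
   Infinite support need not be required: the P_n are infinitely many and
   linearly independent in L^2(mu). *)
Definition is_orthonormal_for (R : realType) (b : nat -> R)
    (mu : probability (measurableTypeR R) R) : Prop :=
  (forall n, mu.-integrable setT (fun x : R => (x ^+ n)%:E)) /\
  (forall m n,
     (\int[mu]_x ((orthopoly b m).[x] * (orthopoly b n).[x])%:E)%E
     = ((m == n)%:R)%:E).

Definition moment (R : realType) (mu : probability (measurableTypeR R) R)
    (n : nat) : R :=
  fine (\int[mu]_x (x ^+ n)%:E)%E.

(* c_k and V_n are extended reals: the series defining c_k has nonnegative
   terms and may diverge when the moment problem is determinate. *)
Definition ccoef (R : realType) (b : nat -> R) (k : nat) : \bar R :=
  sqrte (\sum_(k <= n <oo) (((orthopoly b n)`_k) ^+ 2)%:E)%E.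

Definition Useq (R : realType) (b : nat -> R)
    (mu : probability (measurableTypeR R) R) (n : nat) : R :=
  moment mu (2 * n) / \prod_(i < n) (b i) ^+ 2.

Definition Vseq (R : realType) (b : nat -> R) (n : nat) : \bar R :=
  ((\prod_(i < n) b i)%:E * ccoef b n)%E.

(* The formulas for u, v and k hold for finite a > 0, a > 1 and a > 1; the other
   values are the limits u(0) = v(1) = +oo and u(+oo) = v(+oo) = k(+oo) = 0.
   Arguments below 0 (for u) or 1 (for v and k) give +oo only for totality. *)

(* The integrand is nonnegative since y^a >= 1/2; the supremum over the compact
   interval is a maximum. *)
Definition ufun (R : realType) (alpha : \bar R) : \bar R :=
  match alpha with
  | a%:E =>
    if 0 < a then
      ereal_sup
        [set ((x + 1)%:E *
              \int[lebesgue_measure]_(y in `]x, 1%R[)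
                 (ln (y `^ a / (1 - y `^ a)) / (1 + y) ^+ 2)%:E)%E
        | x in `[2 `^ (- a^-1), 1]]
    else +oo%E
  | +oo%E => 0%E
  | -oo%E => +oo%E
  end.

Definition vfun (R : realType) (alpha : \bar R) : \bar R :=
  match alpha with
  | a%:E =>
    if 1 < a then
      (\int[lebesgue_measure]_(x in `]1%R, +oo[)
          (ln ((1 - x `^ (- a))^-1))%:E)%E
    else +oo%E
  | +oo%E => 0%E
  | -oo%E => +oo%E
  end.

Definition kfun (R : realType) (alpha : \bar R) : \bar R :=
  match alpha with
  | a%:E => ((4 `^ (- a))%:E * expeR (2%:E * ufun a%:E + vfun a%:E))%E
  | +oo%E => 0%E
  | -oo%E => +oo%E
  end.

Definition property_cs_star (R : realType) (b : nat -> R)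
    (mu : probability (measurableTypeR R) R) : Prop :=
  forall m : nat,
    (\sum_(0 <= l <oo) (ccoef b l * `|moment mu (l + m)|%:E) < +oo)%E.

(* Main.v *)
Require Import Defs.
From mathcomp Require Import all_boot all_order all_algebra.
From mathcomp Require Import all_classical all_reals all_analysis.
From mathcomp Require Import measurable_realfun ring lra.
From mathcomp Require Import zify.
Set Implicit Arguments.
Unset Strict Implicit.
Unset Printing Implicit Defensive.
Import Order.TTheory GRing.Theory Num.Theory.
Import numFieldNormedType.Exports.
Local Open Scope classical_set_scope.
Local Open Scope ring_scope.

(** If [a < alpha], the hypothesis gives [b_k / b_n <= ((k + 1) / (n + 1))^a] for
    all [k <= n] with [n] large.

    Writing [x^n = \sum_k A(n, k) P_k], one has [s_2n = \sum_k A(n, k)^2], and the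
    numbers [A(m + j, m - j) / (b_0 ... b_(m+j-1))] satisfy a two-term recurrence
    in [(m, j)] whose coefficients are at most [y_j^a] for [m <= M], where
    [y_j = (M - j + 1) / (M + j)].  Hence they are at most a constant times the
    product of the [max(1, y_i^a / (1 - y_i^a))], and since
    [1 / (1 + y_(i+1)) - 1 / (1 + y_i) = 1 / (2 M + 1)], the logarithm of this
    product is a lower Riemann sum of the integral in [u(a)].

    In the same way the coefficients of [P_(n+2j)] at [x^n], times
    [b_0 ... b_(n-1)], are for [n <= N] at most a constant times a decaying factor
    and the product of the [1 / (1 - (N / (N + 2 l))^a)]; its logarithm is a
    lower Riemann sum of [N v(a) / 2].

    Statements (i) and (ii) follow by letting [a] tend to [alpha].  For the
    series in (iii), [(b_0 ... b_(p-1))^2 / (b_0 ... b_(2p-m-1))] decays like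
    [4^(- a p)].

    For the numerical claim, [v(a) = \sum_k 1 / (k (k a - 1))], and integration by
    parts with [y = exp (- s / a)] reduces [u(a) <= - ln q] to
    [\int_0^(ln (1 + q)) tanh (s / 2 a) / (1 - exp (- s)) ds <= - ln q]. *)

(** * Jacobi recurrences *)

(** The power bound on b_k / b_n carries no constant factor, because each of the roughly n steps of
    a recurrence uses it once and a constant would be raised to the n-th power. Absorbing the
    constant costs a small part of the exponent, hence only a < alpha. The limit then needs
    quantitative left continuity of u and v, and for infinite alpha the bounds u(a) <= 1 / a and
    v(a) <= 2 / (a - 1).

    Both recurrences are beaten by majorants that depend on j alone. Freezing the ratios at the
    largest m (or n) lets the term that keeps j be estimated by the same majorant as the left side;
    solving for it produces the denominators 1 - y^a.

    For A(N, k) the parameters are N = M + j and k = M - j, and the left end x = y_j of the Riemann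
    sum satisfies (1 + x) N = 2 M + 1. So the factor 1 + x in u turns the mesh 1 / (2 M + 1) into
    the exponent N, and the maximum over x covers all k at once. *)

Section jacobi_coefficients.
Variables (R : realType) (b : nat -> R).
Hypothesis b_gt0 : forall n, 0 < b n.

Local Notation P := (orthopoly b).
Local Notation B n := (\prod_(i < n) b i).

Lemma prodb_gt0 n : 0 < B n.
Proof. by apply: prodr_gt0 => i _. Qed.

Lemma prodbS n : B n.+1 = B n * b n.
Proof. by rewrite big_ord_recr. Qed.

Lemma mulX_orthopoly n :
  'X * P n = b n *: P n.+1 + (if n is l.+1 then b l *: P l else 0).
Proof.
by rewrite /= scalerA mulfV ?gt_eqF// scale1r subrK.
Qed.

Lemma coef_orthopolyS n k :
  b n * (P n.+1)`_k =
  (if k is l.+1 then (P n)`_l else 0) - (if n is l.+1 then b l * (P l)`_k else 0).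
Proof.
rewrite -coefZ; have -> : b n *: P n.+1 =
    'X * P n - (if n is l.+1 then b l *: P l else 0).
  by rewrite mulX_orthopoly addrK.
rewrite coefB coefXM; congr (_ - _); first by case: k.
by case: n => [|n]; rewrite ?coef0 ?coefZ.
Qed.

Lemma coef_orthopoly_lead n : (P n)`_n = (B n)^-1.
Proof.
have h m : (size (P m) <= m.+1)%N /\ (size (P m.+1) <= m.+2)%N.
  have sXM (p : {poly R}) l : (size p <= l)%N -> (size ('X * p)%R <= l.+1)%N.
    by move=> pl; rewrite (leq_trans (size_polyMleq _ _))// size_polyX.
  have sZ (c : R) (p : {poly R}) l : (size p <= l)%N -> (size (c *: p) <= l)%N.
    exact/leq_trans/size_scale_leq.
  elim: m => [|m [h1 h2]].
    by split; [rewrite size_poly1|apply/sZ; rewrite subr0; apply/sXM; rewrite size_poly1].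
  split => //; apply/sZ.
  rewrite (leq_trans (size_polyD _ _))// geq_max size_polyN sXM//=.
  exact/sZ/(leq_trans h1)/leqW.
elim: n => [|n ih]; first by rewrite big_ord0 invr1 /= coef1.
apply: (@mulfI _ (b n)); first by rewrite gt_eqF.
rewrite coef_orthopolyS ih prodbS invfM mulrCA mulfV ?gt_eqF// mulr1.
case: n {ih} => [|n]; first by rewrite subr0.
by rewrite nth_default ?mulr0 ?subr0// (leq_trans (h n).1).
Qed.

Lemma coef_orthopoly_odd n k : odd (n + k) -> (P n)`_k = 0.
Proof.
elim/ltn_ind: n k => -[|n] ih k nk; first by rewrite /= coef1; case: k nk.
apply: (@mulfI _ (b n)); first by rewrite gt_eqF.
rewrite coef_orthopolyS mulr0.
case: k nk => [|k] nk; case: n ih nk => [|n] ih nk; rewrite ?subr0 ?sub0r ?oppr0//.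
- by rewrite ih ?mulr0 ?oppr0//; move: nk; rewrite !addn0/= negbK.
- by apply: ih => //; move: nk; rewrite addSn addnS /= negbK.
- have nk1 : odd (n.+1 + k) by move: nk; rewrite !(addSn, addnS)/= !negbK.
  have nk2 : odd (n + k.+1) by move: nk1; rewrite addSnnS.
  by rewrite !ih// mulr0 subr0.
Qed.

(** The A(n, k) of the overview, as a sum over the nonnegative lattice paths of length n from 0 to
    k, a step between l and l + 1 having weight [b l]. All weights are positive, so bounding by
    majorants loses no cancellation. *)
Fixpoint xpow_coef (n k : nat) : R :=
  if n is m.+1 then
    b k * xpow_coef m k.+1 + (if k is l.+1 then b l * xpow_coef m l else 0)
  else (k == 0)%:R.

Lemma xpow_coef_ge0 n k : 0 <= xpow_coef n k.
Proof.
elim: n k => [|n ih] k /=; first by rewrite ler0n.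
have bM i j : 0 <= b i * xpow_coef n j by rewrite mulr_ge0// ltW.
by rewrite addr_ge0//; case: k.
Qed.

Lemma xpow_coef_gt n k : (n < k)%N -> xpow_coef n k = 0.
Proof.
elim: n k => [|n ih] [|k]//= nk.
by rewrite !ih ?mulr0 ?addr0// ltnW// ltnW.
Qed.

Lemma xpow_coefnn n : xpow_coef n n = B n.
Proof.
elim: n => [|n ih]; first by rewrite big_ord0.
by rewrite /= xpow_coef_gt ?ltnS// mulr0 add0r ih prodbS mulrC.
Qed.

Lemma xpow_coef_odd n k : odd (n + k) -> xpow_coef n k = 0.
Proof.
elim: n k => [|n ih] k; first by case: k.
case: k => [|k]; rewrite addSn /= ?addnS /= => h.
  by rewrite ih ?addn1// ?mulr0 ?addr0//; move: h; rewrite addn0.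
by rewrite !ih ?mulr0 ?addr0// ?addnS//=; move: h; rewrite !negbK.
Qed.

Lemma xpow_coefE n m : (n < m)%N ->
  'X^n = \sum_(k < m) xpow_coef n k *: P k.
Proof.
elim: n m => [|n ih] m.
  case: m => // m _; rewrite big_ord_recl/= expr0 scale1r big1 ?addr0// => i _.
  by rewrite scale0r.
case: m => // m nm; rewrite exprS (ih m)// mulr_sumr.
under eq_bigr do rewrite -scalerAr mulX_orthopoly scalerDr scalerA.
rewrite big_split /=.
under [in RHS]eq_bigr do rewrite scalerDl.
rewrite [in RHS]big_split /= addrC; congr (_ + _).
  case: m nm => // m nm.
  rewrite big_ord_recl scaler0 add0r !big_ord_recr /=.
  rewrite !xpow_coef_gt ?ltnS//; last by rewrite ltnW.
  rewrite !mulr0 !scale0r !addr0; apply: eq_bigr => i _.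
  by rewrite scalerA mulrC.
rewrite [in RHS]big_ord_recl scale0r add0r; apply: eq_bigr => i _.
by rewrite mulrC.
Qed.

End jacobi_coefficients.

Lemma le_bigsum2 (R : realType) (F : nat -> nat -> R) n i j :
  (forall i j, 0 <= F i j) -> (i < n)%N -> (j < n)%N ->
  F i j <= \sum_(k < n) \sum_(l < n) F k l.
Proof.
move=> F0 ni nj.
rewrite (bigD1 (Ordinal ni))//= (bigD1 (Ordinal nj))//= -addrA lerDl.
by rewrite addr_ge0// sumr_ge0// => k _; rewrite sumr_ge0.
Qed.

(** * Majorants for the two recurrences *)

Section growth.
Variables (R : realType) (b : nat -> R).
Hypothesis b_gt0 : forall n, 0 < b n.

Local Notation P := (orthopoly b).
Local Notation B n := (\prod_(i < n) b i).

(* The path model: the entry (n, k) = (m + j, m - j) is reached by a step in m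
   or a step in j, and both ratios of weights are at most z j as long as
   m <= M. *)
Lemma xpow_coef_le (n2 : nat) : exists2 K, 1 <= K &
  forall M (z t : nat -> R),
    (forall j, 1 <= t j) -> (forall j, z j * (t j + 1) <= t j) ->
    (forall m j k, (0 < j)%N -> (j <= m)%N -> (m <= M)%N -> (n2 < m + j)%N ->
       (k <= m - j)%N -> b k / b (m + j).-1 <= z j) ->
  forall m j, (m <= M)%N -> (j <= m)%N ->
    xpow_coef b (m + j) (m - j) <= K * B (m + j) * \prod_(i < j) t i.+1.
Proof.
pose F i j := xpow_coef b i j / B i.
have F0 i j : 0 <= F i j by rewrite divr_ge0 ?xpow_coef_ge0// ltW// prodb_gt0.
(* [K] is independent of M: it dominates the entries with first index at most [n2], where no ratio
   bound is available, and the entries with j = 0, which equal 1. Since t >= 1, multiplying by the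
   product preserves this. *)
exists (1 + \sum_(k < n2.+1) \sum_(l < n2.+1) F k l).
  by rewrite lerDl sumr_ge0// => k _; rewrite sumr_ge0.
set K := 1 + _; move=> M z t t1 zt bz m j.
have K1 : 1 <= K by rewrite lerDl sumr_ge0// => k _; rewrite sumr_ge0.
have K0 : 0 <= K by rewrite (le_trans ler01).
have C1 l : 1 <= \prod_(i < l) t i.+1.
  by elim: l => [|l ih]; rewrite ?big_ord0// big_ord_recr /= mulr_ege1.
have [s] := ubnP (m + j)%N; elim: s m j => // s ih m j; rewrite ltnS => ms mM jm.
have B0 := prodb_gt0 b_gt0.
case: j => [|j] in ms jm *.
  by rewrite addn0 subn0 xpow_coefnn// big_ord0 mulr1 ler_peMl// ltW.
have [mjn|nmj] := leqP (m + j.+1) n2.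
  apply: (@le_trans _ _ (K * B (m + j.+1))); last first.
    by rewrite ler_peMr// mulr_ge0// ltW.
  rewrite -ler_pdivrMr//.
  have := @le_bigsum2 R F n2.+1 (m + j.+1)%N (m - j.+1)%N F0.
  by move=> /(_ _ _)/le_trans; apply; rewrite ?ltnS ?lerDr//; lia.
have -> : (m + j.+1 = (m + j).+1)%N by rewrite addnS.
rewrite prodbS big_ord_recr/=.
set k := (m - j.+1)%N.
have k1 : (k.+1 = m - j)%N by rewrite /k; lia.
have b0 := b_gt0 (m + j).
set C := \prod_(i < j) _.
have c1 : xpow_coef b (m + j) k.+1 <= K * B (m + j) * C.
  by rewrite k1; apply: ih => //; lia.
have := zt j.+1; set T := t j.+1; set Z := z j.+1 => ZT.
have T1 : 1 <= T by exact: t1.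
have C0 : 0 <= C by apply: le_trans ler01 (C1 j).
have KB : 0 <= K * B (m + j) by rewrite mulr_ge0// ltW.
have bZ l : (l <= k)%N -> b l <= Z * b (m + j).
  move=> lk; rewrite -ler_pdivrMr//; have := bz m j.+1 l; rewrite addnS.
  by apply; clear -lk nmj jm mM k; lia.
have [c2 c20] : (if k is l.+1 then b l * xpow_coef b (m + j) l else 0)
           <= Z * b (m + j) * (K * B (m + j) * (C * T)) /\ 0 <= Z * b (m + j).
  split; last by apply: le_trans (bZ k _) => //; exact/ltW.
  have Zb : 0 <= Z * b (m + j) by apply: le_trans (bZ k _) => //; exact/ltW.
  case E : k => [|l].
    by rewrite mulr_ge0// mulr_ge0// mulr_ge0// (le_trans ler01).
  apply: ler_pM; rewrite ?xpow_coef_ge0//; first exact/ltW.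
    by apply: bZ; rewrite E.
  have := ih m.-1 j.+1; rewrite big_ord_recr/=.
  have [-> ->] : (m.-1 + j.+1 = m + j)%N /\ (m.-1 - j.+1 = l)%N.
    by clear -E k1 jm; split; lia.
  by apply; clear -E ms mM jm k1; lia.
have c3 : b k * xpow_coef b (m + j) k.+1 <= Z * b (m + j) * (K * B (m + j) * C).
  by apply: ler_pM; rewrite ?xpow_coef_ge0//; [exact/ltW|exact: bZ].
(* The entries (m, j) and (m - 1, j + 1) contribute C and C T, each with a factor at most Z; the
   condition Z (T + 1) <= T is what reproduces the majorant C T. *)
apply: le_trans (lerD c3 c2) _.
have -> : Z * b (m + j) * (K * B (m + j) * C) +
    Z * b (m + j) * (K * B (m + j) * (C * T)) =
  (K * B (m + j) * C * b (m + j)) * (Z * (T + 1)) by ring.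
have -> : K * (B (m + j) * b (m + j)) * (C * T) =
  (K * B (m + j) * C * b (m + j)) * T by ring.
by rewrite ler_wpM2l// mulr_ge0 ?mulr_ge0// ltW.
Qed.

(** The weight [B n] turns the coefficients of the recurrence into the ratios b_(n-1) / b_(q+1) and
    b_q / b_(q+1), bounded by [bet] and [gam]. Signs are given up in the triangle inequality; for n
    = 0 the first term is absent. *)
Lemma coef_orthopoly_step n q (bet gam X Y : R) :
  b q <= gam * b q.+1 -> 0 <= gam -> 0 <= bet * X ->
  (if n is l.+1 then b l <= bet * b q.+1 /\ B l * `|(P q.+1)`_l| <= X else True) ->
  B n * `|(P q)`_n| <= Y -> 0 <= X ->
  B n * `|(P q.+2)`_n| <= bet * X + gam * Y.
Proof.
move=> bgam gam0 bX0 hX hY X0.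
have B0 := prodb_gt0 b_gt0.
have c1 : B n * (b q * `|(P q)`_n|) <= b q.+1 * (gam * Y).
  rewrite mulrCA (le_trans (ler_wpM2l _ hY)) ?(ltW (b_gt0 q))//.
  rewrite mulrA (mulrC (b q.+1)) ler_wpM2r//.
  by apply: le_trans hY; rewrite mulr_ge0// ltW.
have c2 : B n * (if n is l.+1 then `|(P q.+1)`_l| else 0) <= b q.+1 * (bet * X).
  case: n {c1 hY} hX => [_|n [bbet hX]].
    by rewrite mulr0 mulr_ge0// ltW.
  rewrite prodbS -mulrA (mulrCA (B n)).
  rewrite (le_trans (ler_wpM2l _ hX)) ?(ltW (b_gt0 _))//.
  by rewrite [leRHS]mulrA (mulrC (b q.+1)) ler_wpM2r.
rewrite -(ler_pM2l (b_gt0 q.+1)) mulrCA -[b q.+1 in X in X <= _]gtr0_norm//.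
rewrite -normrM coef_orthopolyS// mulrDr.
apply: le_trans (lerD c2 c1).
rewrite -mulrDr ler_wpM2l ?(ltW (B0 n))// (le_trans (ler_normB _ _))//.
by rewrite normrM (gtr0_norm (b_gt0 q)) lerD2r; case: (n) => //; rewrite normr0.
Qed.

(** The product C_j solves C_(j+1) = h C_(j+1) + g C_j, where h multiplies the entry (n - 1, j + 1)
    and g the entry (n, j). The lower bound [gam] on g gives C_j >= gam^j, so that [K], chosen
    before N, g and h, covers the finitely many entries with n + 2 j <= n2. *)
Lemma coef_orthopoly_le (n2 : nat) (gam : R) : 0 < gam <= 1 ->
  exists2 K, 0 <= K &
  forall N (g h : nat -> R),
    (forall j, gam <= g j) -> (forall j, (0 < j)%N -> 0 <= h j < 1) ->
    (forall n j, (0 < j)%N -> (n <= N)%N -> (n2 < n + j.*2)%N ->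
       ((0 < n)%N -> b n.-1 / b (n + j.*2).-1 <= h j) /\
       b (n + j.*2).-2 / b (n + j.*2).-1 <= g j) ->
  forall n j, (n <= N)%N ->
    B n * `|(P (n + j.*2))`_n| <= K * \prod_(i < j) (g i.+1 / (1 - h i.+1)).
Proof.
move=> /andP[gam0 gam1].
pose F m n := B n * `|(P m)`_n|.
have B0 := prodb_gt0 b_gt0.
have F0 i j : 0 <= F i j by rewrite mulr_ge0// ltW.
have gn0 : 0 < gam ^+ n2 by rewrite exprn_gt0.
have [K [K0 Kgam Ksmall]] : exists K, [/\ 0 <= K, 1 <= K * gam ^+ n2 &
    forall n m, (m <= n2)%N -> (n <= n2)%N -> F m n <= K * gam ^+ n2].
  pose S := \sum_(k < n2.+1) \sum_(l < n2.+1) F k l.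
  have S0 : 0 <= S by rewrite sumr_ge0// => k _; rewrite sumr_ge0.
  exists ((1 + S) / gam ^+ n2); rewrite mulfVK ?gt_eqF//; split.
  - by rewrite divr_ge0 ?addr_ge0// ltW.
  - by rewrite lerDl.
  - move=> n m mn nn; rewrite (le_trans _ (_ : S <= _)) ?lerDr//.
    exact: (@le_bigsum2 R F).
exists K => // N g h gg h1 bh n j.
pose C l := \prod_(i < l) (g i.+1 / (1 - h i.+1)).
have CS l : C l.+1 = C l * (g l.+1 / (1 - h l.+1)) by exact: big_ord_recr.
have C1 l : gam ^+ l <= C l.
  elim: l => [|l ih]; first by rewrite /C big_ord0 expr0.
  rewrite CS exprSr.
  apply: ler_pM => //; rewrite ?exprn_ge0 ?(ltW gam0)//.
  have /andP[h0 hl1] := h1 l.+1 isT.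
  rewrite ler_pdivlMr ?subr_gt0//; apply: le_trans (gg l.+1).
  by rewrite ler_piMr ?(ltW gam0)// lerBlDr lerDl.
have C0 l : 0 <= C l by apply: le_trans (C1 l); rewrite exprn_ge0// ltW.
rewrite -/(C j); clearbody C.
have [s] := ubnP (n + j)%N; elim: s n j => // s ih n j; rewrite ltnS => ms nN.
have [mjn|nmj] := leqP (n + j.*2) n2.
  have /(le_trans (Ksmall n _ mjn _)) -> // : K * gam ^+ n2 <= K * C j.
    rewrite ler_wpM2l//; apply: le_trans (C1 j).
    by rewrite ler_wiXn2l ?(ltW gam0)//; clear -mjn; lia.
  by clear -mjn; lia.
case: j => [|j] in ms nmj *.
  rewrite addn0 coef_orthopoly_lead// gtr0_norm ?invr_gt0// mulfV ?gt_eqF//.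
  rewrite (le_trans Kgam)// ler_wpM2l// (le_trans _ (C1 0%N))//.
  by rewrite expr0 exprn_ile1// ltW.
have [] := bh n j.+1 isT nN nmj.
have eq2 : (n + j.+1.*2 = (n + j.*2).+2)%N by rewrite doubleS !addnS.
rewrite eq2 -[_.+2.-1]/(_.+1) -[_.+2.-2]/(n + j.*2)%N !ler_pdivrMr//.
have /andP[h0 hl1] := h1 j.+1 isT.
have g0 : 0 < g j.+1 by rewrite (lt_le_trans gam0).
have D0 : 0 <= K * C j.+1 by rewrite mulr_ge0.
move=> bh1 bg1.
have h10 : 1 - h j.+1 != 0 by rewrite gt_eqF ?subr_gt0.
have -> : K * C j.+1 = h j.+1 * (K * C j.+1) + g j.+1 * (K * C j).
  by rewrite CS; field.
apply: (@coef_orthopoly_step n (n + j.*2)) => //; [exact: ltW|exact: mulr_ge0| |].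
  case: n => [|n] in ms nN nmj eq2 bh1 bg1 * => //; split; first exact: bh1.
  have -> : ((n.+1 + j.*2).+1 = n + j.+1.*2)%N by rewrite doubleS !addnS !addSn.
  by apply: ih; [clear -ms; lia|exact: ltnW].
by apply: ih => //; clear -ms; lia.
Qed.

End growth.

(** * Integrals bounded through antiderivatives *)

Section antiderivatives.
Variable R : realType.
Implicit Types (F f : R -> R) (a b : R).
Local Notation mu := (@lebesgue_measure R).

Lemma is_derive_continuous F (x d : R) : is_derive x 1 F d -> {for x, continuous F}.
Proof.
by move=> [dF _]; apply: differentiable_continuous; apply/derivable1_diffP.
Qed.

Lemma integral_is_derive F f a b : a < b ->
  (forall x, a <= x <= b -> is_derive x 1 F (f x)) ->
  (forall x, a <= x <= b -> {for x, continuous f}) ->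
  (\int[mu]_(x in `[a, b]) (f x)%:E = (F b - F a)%:E)%E.
Proof.
move=> ab dF cf; rewrite EFinB; apply: continuous_FTC2 => //.
- by apply: continuous_in_subspaceT => x; rewrite inE/= in_itv/= => /cf.
- split.
  + by move=> x; rewrite in_itv/= => /andP[ax xb]; have [] := dF x; rewrite ?ltW.
  + apply: cvg_at_right_filter; apply: is_derive_continuous (dF a _).
    by rewrite lexx ltW.
  + apply: cvg_at_left_filter; apply: is_derive_continuous (dF b _).
    by rewrite lexx ltW.
- move=> x; rewrite in_itv/= => /andP[ax xb]; rewrite derive1E.
  by apply: derive_val; apply: dF; rewrite !ltW.
Qed.

Lemma measurable_itv_oo f a b :
  (forall x, a < x < b -> {for x, continuous f}) -> measurable_fun `]a, b[ f.
Proof.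
move=> cf; apply: open_continuous_measurable_fun; first exact: interval_open.
by move=> x; rewrite inE/= in_itv/=; exact: cf.
Qed.

Lemma measurable_itv_co f a b :
  (forall x, a <= x < b -> {for x, continuous f}) -> measurable_fun `[a, b[ f.
Proof.
move=> cf; have [ab|ba] := ltP a b; last first.
  by rewrite set_itv_ge ?bnd_simp -?leNgt//; exact: measurable_fun_set0.
rewrite -(@setU1itv _ _ _ _ false) ?bnd_simp//; apply/measurable_funU => //; split.
  exact: measurable_fun_set1.
by apply: measurable_itv_oo => x /andP[ax xb]; apply: cf; rewrite ltW.
Qed.

(* Only a bound on the increments of F is needed at the right end point, where f
   may be unbounded. *)
Lemma integral_oo_le_antiderivative F f a b D : a < b -> 0 <= D ->
  (forall x, a <= x < b -> 0 <= f x) ->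
  (forall x, a <= x < b -> is_derive x 1 F (f x)) ->
  (forall x, a <= x < b -> {for x, continuous f}) ->
  (forall z, a < z < b -> F z - F a <= D) ->
  (\int[mu]_(x in `]a, b[) (f x)%:E <= D%:E)%E.
Proof.
move=> ab D0 f0 dF cf FD.
rewrite integral_itv_obnd_cbnd; last first.
  apply/measurable_EFinP; apply: measurable_itv_oo => x /andP[ax xb].
  by apply: cf; rewrite ltW.
rewrite itv_bnd_open_bigcup.
have sub i : `[a, (b - i.+1%:R^-1)] `<=` `[a, b[.
  by apply: subset_itvl; rewrite bnd_simp ltrBlDr ltrDl invr_gt0.
have mf i : measurable_fun `[a, (b - i.+1%:R^-1)] (EFin \o f).
  apply/measurable_EFinP; apply: (measurable_funS _ (sub i)) => //.
  exact: measurable_itv_co.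
have nd : nondecreasing_seq (fun i => `[a, (b - i.+1%:R^-1)]%classic : set R).
  apply/nondecreasing_seqP => n; apply/subsetPset; apply: subset_itvl.
  by rewrite bnd_simp lerD2l lerN2 lef_pV2 ?posrE// ler_nat.
have h i x : `[a, (b - i.+1%:R^-1)]%classic x -> (0 <= (f x)%:E)%E.
  by move=> /sub /=; rewrite in_itv/= lee_fin; exact: f0.
have /cvg_lim <- // := @ge0_nondecreasing_set_cvg_integral _ _ _ _ _ mu nd
  (fun i => measurable_itv _) mf h.
apply: lime_le.
  apply/ereal_nondecreasing_is_cvgn/ge0_nondecreasing_set_nondecreasing_integral => //.
near=> n; set z := b - _.
have zb : z < b by rewrite ltrBlDr ltrDl invr_gt0.
have [az|za] := ltP a z.
  have dz x : a <= x <= z -> is_derive x 1 F (f x).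
    by move=> /andP[ax xz]; apply: dF; rewrite ax (le_lt_trans xz).
  have cz x : a <= x <= z -> {for x, continuous f}.
    by move=> /andP[ax xz]; apply: cf; rewrite ax (le_lt_trans xz).
  by rewrite (integral_is_derive az dz cz) lee_fin FD// az.
have [e|ne] := eqVneq a z; first by rewrite -e set_itv1 integral_set1 lee_fin.
by rewrite set_itv_ge ?integral_set0 ?lee_fin// bnd_simp -ltNge lt_neqAle eq_sym ne.
Unshelve. all: by end_near. Qed.

Lemma integral_oc_ge (f : R -> R) a b (g : R) : a <= b -> 0 <= g ->
  measurable_fun `]a, b] f -> (forall x, a < x <= b -> g <= f x) ->
  ((g * (b - a))%:E <= \int[mu]_(x in `]a, b]) (f x)%:E)%E.
Proof.
move=> ab g0 mf gf.
apply: (@le_trans _ _ (\int[mu]_(x in `]a, b]) (cst g%:E x))%E).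
  rewrite integral_cst//= lebesgue_measure_itv/= lte_fin.
  have [_|ba] := ltP a b; first by rewrite EFinM EFinB.
  by rewrite mule0 lee_fin mulr_ge0_le0// subr_le0.
by apply: ge0_le_integral => //=; exact/measurable_EFinP.
Qed.

End antiderivatives.

(** * The function u *)

Section ufun.
Variable R : realType.
Implicit Types a x y z : R.
Local Notation mu := (@lebesgue_measure R).

Definition phi a y : R := a * ln y - ln (1 - y `^ a).
(** The positive part reflects the lower bound 1 on the factors of the majorant, and keeps the
    integrand of u nonnegative also below [xhalf a], where [phi] is negative. *)
Definition phip a y : R := Num.max 0 (phi a y).

Lemma powR_itv01 a y : 0 < a -> 0 < y < 1 -> 0 < y `^ a < 1.
Proof.
move=> a0 /andP[y0 y1]; rewrite powR_gt0//=.
have <- : 1 `^ a = 1 :> R by rewrite powR1.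
by apply: gt0_ltr_powR => //; rewrite nnegrE// ltW.
Qed.

Lemma powR_le_itv01 a x y : 0 < a -> 0 < x -> x <= y -> x `^ a <= y `^ a.
Proof.
move=> a0 x0 xy; apply: ge0_ler_powR; rewrite ?nnegrE// ltW//.
exact: lt_le_trans xy.
Qed.

Lemma phiE a y : 0 < a -> 0 < y < 1 -> ln (y `^ a / (1 - y `^ a)) = phi a y.
Proof.
move=> a0 y01; have /andP[ya0 ya1] := powR_itv01 a0 y01.
by rewrite ln_div ?posrE ?subr_gt0// ln_powR.
Qed.

Lemma phi_le a x y : 0 < a -> 0 < x -> x <= y -> y < 1 -> phi a x <= phi a y.
Proof.
move=> a0 x0 xy y1.
have y0 : 0 < y by rewrite (lt_le_trans x0).
have /andP[xa0 xa1] : 0 < x `^ a < 1 by rewrite powR_itv01// x0 (le_lt_trans xy).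
have /andP[ya0 ya1] : 0 < y `^ a < 1 by rewrite powR_itv01// y0.
have xya := powR_le_itv01 a0 x0 xy.
rewrite lerB//; first by rewrite ler_wpM2l ?(ltW a0)// ler_ln.
by rewrite ler_ln ?posrE ?subr_gt0// lerD2l lerN2.
Qed.

Lemma phip_ge0 a y : 0 <= phip a y.
Proof. by rewrite /phip le_max lexx. Qed.

Lemma phip_le a x y : 0 < a -> 0 < x -> x <= y -> y < 1 -> phip a x <= phip a y.
Proof.
by move=> a0 x0 xy y1; rewrite /phip ge_max phip_ge0 le_max phi_le ?orbT.
Qed.

Definition xhalf a : R := 2 `^ (- a^-1).

Lemma xhalf_itv a : 0 < a -> 0 < xhalf a < 1.
Proof.
move=> a0; rewrite powR_gt0//= /xhalf /powR gt_eqF// expR_lt1 mulNr oppr_lt0.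
by rewrite mulr_gt0 ?invr_gt0// ln_gt0// ltr1n.
Qed.

Lemma phi_xhalf a : 0 < a -> phi a (xhalf a) = 0.
Proof.
move=> a0; rewrite -phiE// ?xhalf_itv// -powRrM mulNr mulVf ?gt_eqF// powR_inv1//.
have -> : 1 - 2^-1 = 2^-1 :> R by field.
by rewrite divff ?ln1// invr_eq0.
Qed.

Lemma phi_ge0 a y : 0 < a -> xhalf a <= y -> y < 1 -> 0 <= phi a y.
Proof.
move=> a0 ya y1; have /andP[x0 _] := xhalf_itv a0.
by rewrite -(phi_xhalf a0) phi_le.
Qed.

Lemma phi_le0 a y : 0 < a -> 0 < y -> y <= xhalf a -> phi a y <= 0.
Proof.
move=> a0 y0 ya; have /andP[_ x1] := xhalf_itv a0.
by rewrite -(phi_xhalf a0) phi_le.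
Qed.

Lemma is_derive_phi a y : 0 < a -> 0 < y < 1 ->
  is_derive y 1 (phi a) (a / (y * (1 - y `^ a))).
Proof.
move=> a0 y01; have /andP[y0 y1] := y01.
have /andP[ya0 ya1] := powR_itv01 a0 y01.
pose pa (x : R) := x `^ a.
have d1 : is_derive y 1 pa (a * y `^ (a - 1)) by exact: is_derive1_powR.
have d2 := is_deriveB (is_derive_cst (1 : R) y 1) d1.
have p0 : 0 < (cst 1 - pa) y by rewrite subr_gt0.
have d3 := is_derive1_comp (is_derive1_ln p0) d2.
have d4 := is_deriveZ a (is_derive1_ln y0).
apply: is_derive_eq (is_deriveB d4 d3) _.
rewrite -[(cst 1 - _) y]/(1 - y `^ a) -[a *: y^-1]/(a * y^-1).
have -> : y `^ (a - 1) = y `^ a / y.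
  by rewrite powRB ?powRr1 ?(ltW y0)// (gt_eqF y0) implybT.
by field; rewrite !gt_eqF// subr_gt0.
Qed.

Lemma continuous_phi a y : 0 < a -> 0 < y < 1 -> {for y, continuous (phi a)}.
Proof. by move=> a0 y01; apply: is_derive_continuous (is_derive_phi a0 y01). Qed.

Definition wgt y : R := ((1 + y) ^+ 2)^-1.

Lemma wgt_ge0 y : 0 <= wgt y.
Proof. by rewrite invr_ge0 sqr_ge0. Qed.

Lemma is_derive_wgt y : 0 < 1 + y -> is_derive y 1 (fun x => - (1 + x)^-1) (wgt y).
Proof.
move=> y0; have d1 := is_deriveD (is_derive_cst (1 : R) y 1) (is_derive_id y 1).
have ne : (cst 1 + id) y != 0 :> R by rewrite gt_eqF.
apply: is_derive_eq (is_deriveN (is_deriveV ne d1)) _.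
by rewrite add0r -[(cst 1 + id) y]/(1 + y) -exprVn /wgt -exprVn scaleNr opprK; exact: mulr1.
Qed.

Lemma continuous_wgt y : 0 < 1 + y -> {for y, continuous wgt}.
Proof.
move=> y0; apply: cvgV; first by rewrite gt_eqF// exprn_gt0.
apply: (@cvg_comp _ _ _ (fun y => 1 + y) (fun z : R => z ^+ 2) _ (nbhs (1 + y))).
  by apply: cvgD; [exact: cvg_cst|exact: cvg_id].
exact: exprn_continuous.
Qed.

End ufun.

(** * Riemann sums for u *)

Section ufun_integral.
Variable R : realType.
Implicit Types a x y z k : R.
Local Notation mu := (@lebesgue_measure R).

Lemma integral_kwgt k x z (b0 b1 : bool) : 0 <= x -> x < z ->
  (\int[mu]_(y in [set` Interval (BSide b0 x) (BSide b1 z)]) (k * wgt y)%:E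
   = (k * ((1 + x)^-1 - (1 + z)^-1))%:E)%E.
Proof.
move=> x0 xz; pose f y := k * wgt y.
have pos y : x <= y <= z -> 0 < 1 + y.
  by move=> /andP[xy _]; rewrite ltr_pwDl// (le_trans x0).
have df y : x <= y <= z -> is_derive y 1 (k \*: (fun x : R => - (1 + x)^-1)) (f y).
  by move=> /pos y0; exact: is_deriveZ (is_derive_wgt y0).
have cf y : x <= y <= z -> {for y, continuous f}.
  by move=> /pos y0; apply: cvgM; [exact: cvg_cst|exact: continuous_wgt].
rewrite integral_itv_bndoo; last first.
  apply/measurable_EFinP; apply: (@measurable_itv_oo R f) => y /andP[xy yz].
  by apply: cf; rewrite !ltW.
transitivity (\int[mu]_(y in `[x, z]) (f y)%:E)%E.
  symmetry; apply: integral_itv_bndoo.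
  apply/measurable_EFinP; apply: (@measurable_itv_oo R f) => y /andP[xy yz].
  by apply: cf; rewrite !ltW.
rewrite (integral_is_derive xz df cf); congr EFin.
rewrite -[(_ \*: _) z]/(k * - (1 + z)^-1) -[(_ \*: _) x]/(k * - (1 + x)^-1).
by ring.
Qed.

Definition Up a x : \bar R := (\int[mu]_(y in `]x, 1%R[) (phip a y * wgt y)%:E)%E.

Lemma measurable_phip_wgt a x : 0 < a -> 0 <= x ->
  measurable_fun `]x, 1[ (fun y => phip a y * wgt y).
Proof.
move=> a0 x0; apply: measurable_funM.
  apply: measurable_maxr; first exact: measurable_cst.
  apply: measurable_itv_oo => y /andP[xy y1].
  by apply: continuous_phi => //; rewrite (le_lt_trans x0).
apply: measurable_itv_oo => y /andP[xy y1].
by apply: continuous_wgt; rewrite ltr_pwDl// (le_trans x0)// ltW.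
Qed.

Lemma phip_wgt_ge0 a y : 0 <= phip a y * wgt y.
Proof. by rewrite mulr_ge0 ?phip_ge0 ?wgt_ge0. Qed.

Lemma Up_ge0 a x : (0 <= Up a x)%E.
Proof. by apply: integral_ge0 => y _; rewrite lee_fin phip_wgt_ge0. Qed.

Lemma UpE a x : 0 < a -> xhalf a <= x ->
  (\int[mu]_(y in `]x, 1%R[)
     (ln (y `^ a / (1 - y `^ a)) / (1 + y) ^+ 2)%:E = Up a x)%E.
Proof.
move=> a0 ax; apply: eq_integral => y; rewrite inE/= in_itv/= => /andP[xy y1].
have /andP[xh0 _] := xhalf_itv a0.
rewrite phiE//; last by rewrite y1 (lt_trans xh0)// (le_lt_trans ax).
by rewrite /phip max_r// phi_ge0// (le_trans ax)// ltW.
Qed.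

Lemma le_ufun a x : 0 < a -> xhalf a <= x <= 1 ->
  ((1 + x)%:E * Up a x <= ufun a%:E)%E.
Proof.
move=> a0 xa1; have /andP[ax x1] := xa1.
rewrite /ufun a0; apply: ereal_sup_ubound => /=; exists x.
  by rewrite in_itv/= -/(xhalf a).
by rewrite UpE// addrC.
Qed.

Lemma ufun_le a (c : \bar R) : 0 < a ->
  (forall x, xhalf a <= x <= 1 -> ((1 + x)%:E * Up a x <= c)%E) ->
  (ufun a%:E <= c)%E.
Proof.
move=> a0 h; rewrite /ufun a0; apply: ge_ereal_sup => _ [x xa1 <-].
move: xa1; rewrite /= in_itv/= -/(xhalf a) => xa1; have /andP[ax _] := xa1.
by rewrite UpE// addrC h.
Qed.

Lemma Up_split a x z : 0 < a -> 0 <= x -> x <= z -> z < 1 ->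
  (Up a x = \int[mu]_(y in `]x, z]) (phip a y * wgt y)%:E + Up a z)%E.
Proof.
move=> a0 x0 xz z1.
rewrite /Up (@itv_bndbnd_setU _ _ (BRight x) (BRight z) (BLeft 1)) ?bnd_simp//.
rewrite ge0_integral_setU//=.
- rewrite -itv_bndbnd_setU ?bnd_simp//.
  by apply/measurable_EFinP; exact: measurable_phip_wgt.
- by move=> y _; rewrite lee_fin phip_wgt_ge0.
- apply/disj_setPS => y /=; rewrite !in_itv/= => -[/andP[_ yz] /andP[zy _]].
  by move: (lt_le_trans zy yz); rewrite ltxx.
Qed.

Lemma Up_step a x z : 0 < a -> 0 < x -> x <= z -> z < 1 ->
  ((phip a x * ((1 + x)^-1 - (1 + z)^-1))%:E + Up a z <= Up a x)%E.
Proof.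
move=> a0 x0 xz z1; rewrite (Up_split a0 (ltW x0) xz z1) leeD2r//.
have [xz'|zx] := ltP x z; last first.
  have -> : x = z by apply/le_anti; rewrite xz.
  rewrite subrr mulr0; apply: integral_ge0 => y _.
  by rewrite lee_fin phip_wgt_ge0.
rewrite -(integral_kwgt _ false false (ltW x0) xz').
apply: ge0_le_integral => //=.
- by move=> y _; rewrite lee_fin mulr_ge0 ?phip_ge0 ?wgt_ge0.
- apply/measurable_EFinP; apply: measurable_funM; first exact: measurable_cst.
  apply: (@measurable_funS _ _ _ _ `]x, 1[) => //.
    by apply: subset_itvl; rewrite bnd_simp.
  apply: measurable_itv_oo => y /andP[xy y1].
  by apply: continuous_wgt; rewrite ltr_pwDl// (le_trans (ltW x0))// ltW.
- apply/measurable_EFinP; apply: (@measurable_funS _ _ _ _ `]x, 1[) => //.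
    by apply: subset_itvl; rewrite bnd_simp.
  by apply: measurable_phip_wgt => //; exact: ltW.
- move=> y; rewrite in_itv/= => /andP[xy yz].
  rewrite lee_fin ler_wpM2r ?wgt_ge0// phip_le//; first exact: ltW.
  exact: le_lt_trans z1.
Qed.

(** Grid points may lie below [xhalf a], outside the range of the supremum. There the integrand
    vanishes, so moving x up to [xhalf a] keeps the integral and only increases 1 + x. *)
Lemma Up_le_ufun a x : 0 < a -> 0 < x <= 1 ->
  ((1 + x)%:E * Up a x <= ufun a%:E)%E.
Proof.
move=> a0 /andP[x0 x1]; have /andP[h0 h1] := xhalf_itv a0.
have [hx|xh] := leP (xhalf a) x; first by apply: le_ufun => //; rewrite hx.
apply: (@le_trans _ _ ((1 + xhalf a)%:E * Up a (xhalf a))%E); last first.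
  by apply: le_ufun => //; rewrite lexx ltW.
rewrite (Up_split a0 (ltW x0) (ltW xh) h1) integral0_eq ?add0e.
  rewrite lee_wpmul2r ?Up_ge0// lee_fin lerD2l ltW//.
move=> y /=; rewrite in_itv/= => /andP[xy yh].
by rewrite /phip max_l ?mul0r// phi_le0// (lt_trans x0).
Qed.

(* The values y_i split the interval so that the weight (1 + y)^-2 has the same
   integral 1 / (2 M + 1) over each piece. *)
Definition ygrid (M i : nat) : R := (M - i).+1%:R / (M + i)%:R.

Lemma ygrid_itv M i : (0 < i)%N -> (i <= M)%N -> 0 < ygrid M i < 1.
Proof.
move=> i0 iM; have Mi : (0 < M + i)%N by rewrite addn_gt0 i0 orbT.
rewrite /ygrid divr_gt0 ?ltr0n//= ltr_pdivrMr ?ltr0n// mul1r ltr_nat.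
by lia.
Qed.

Lemma ygridE M i : (0 < i)%N -> (i <= M)%N ->
  (1 + ygrid M i)^-1 = (M + i)%:R / (M.*2.+1)%:R.
Proof.
move=> i0 iM; have Mi : (M + i)%:R != 0 :> R by rewrite pnatr_eq0; lia.
rewrite -invf_div; congr _^-1; rewrite -[1 in LHS](divff Mi) -mulrDl -natrD.
by congr (_%:R / _); lia.
Qed.

(** The sum starts at y_2: the term at y_i is the rectangle over the interval from y_i to y_(i-1),
    and y_0 would exceed 1. The term at y_1 has to be bounded separately. *)
Lemma sum_phip_le a u M j : 0 < a -> (ufun a%:E <= u%:E)%E ->
  (0 < j)%N -> (j <= M)%N ->
  \sum_(i < j.-1) phip a (ygrid M i.+2) <= (M + j)%:R * u.
Proof.
move=> a0 ua j0 jM.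
pose S := \sum_(i < j.-1) phip a (ygrid M i.+2).
have h l : (l < M)%N ->
  ((\sum_(i < l) phip a (ygrid M i.+2) / (M.*2.+1)%:R)%:E <= Up a (ygrid M l.+1))%E.
  elim: l => [|l ih] lM; first by rewrite big_ord0 Up_ge0.
  have /andP[y0 y1] := @ygrid_itv M l.+2 isT lM.
  have /andP[z0 z1] := @ygrid_itv M l.+1 isT (ltnW lM).
  have yz : ygrid M l.+2 <= ygrid M l.+1.
    rewrite /ygrid ler_pM ?invr_ge0 ?ler0n// ?ler_nat; first by lia.
    by rewrite lef_pV2 ?posrE ?ltr0n ?ler_nat; lia.
  apply: le_trans (Up_step a0 y0 yz z1).
  rewrite big_ord_recr/= EFinD addeC leeD// ?ih 1?ltnW//.
  rewrite lee_fin ler_wpM2l ?phip_ge0//.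
  rewrite (@ygridE M l.+2)// (@ygridE M l.+1) ?(ltnW lM)// -mulrBl -natrB; last by lia.
  by rewrite (_ : (_ - _)%N = 1%N) ?mul1r//; lia.
have := h j.-1; rewrite prednK// => /(_ jM) hj.
have /andP[y0 y1] := ygrid_itv j0 jM.
have := Up_le_ufun a0 (_ : 0 < ygrid M j <= 1).
rewrite y0 ltW// => /(_ isT) /le_trans/(_ ua).
have p1 : 0 <= 1 + ygrid M j by rewrite addr_ge0// ltW.
move=> /(le_trans (lee_wpmul2l _ hj)); rewrite lee_fin p1 => /(_ isT).
rewrite -EFinM lee_fin -mulr_suml -/S.
have -> : 1 + ygrid M j = (M.*2.+1)%:R / (M + j)%:R by rewrite -invf_div -ygridE// invrK.
have Mj : 0 < (M + j)%:R :> R by rewrite ltr0n; lia.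
rewrite -ler_pdivrMl// => Su; apply: le_trans Su.
rewrite le_eqVlt; apply/orP; left; apply/eqP; field.
by rewrite nat1r -natrD !pnatr_eq0 addn_eq0 negb_and -!lt0n j0 orbT.
Qed.

(** The integral of the weight over ]x, 1[, times 1 + x, is 1 - (1 + x) / 2 <= 1; raising [phi] by
    [D] therefore raises u by at most [D]. *)
Lemma ufun_le_add a a' D : 0 < a -> 0 < a' -> 0 <= D ->
  (forall y, xhalf a' < y -> y < 1 -> phi a' y <= phip a y + D) ->
  (ufun a'%:E <= ufun a%:E + D%:E)%E.
Proof.
move=> a0 a'0 D0 hD; apply: ufun_le => // x /andP[hx].
rewrite le_eqVlt => /predU1P[->|x1].
  rewrite /Up set_itvoo0 integral_set0 mule0 adde_ge0 ?lee_fin//.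
  apply: le_trans (@Up_le_ufun a 1 a0 _); last by rewrite ltr01 lexx.
  by rewrite mule_ge0 ?Up_ge0// lee_fin addr_ge0.
have /andP[h0 h1] := xhalf_itv a'0.
have x0 : 0 < x by rewrite (lt_le_trans h0).
have pos : 0 < 1 + x by rewrite addr_gt0.
apply: (@le_trans _ _ ((1 + x)%:E * (Up a x +
    \int[mu]_(y in `]x, 1%R[) (D * wgt y)%:E))%E).
  rewrite lee_wpmul2l ?lee_fin ?(ltW pos)// /Up -ge0_integralD//=.
  - apply: ge0_le_integral => //=.
    + by move=> y _; rewrite lee_fin phip_wgt_ge0.
    + by apply/measurable_EFinP; apply: measurable_phip_wgt => //; exact: ltW.
    + apply: emeasurable_funD; apply/measurable_EFinP.
        by apply: measurable_phip_wgt => //; exact: ltW.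
      apply: measurable_funM; first exact: measurable_cst.
      apply: measurable_itv_oo => y /andP[xy y1].
      by apply: continuous_wgt; rewrite ltr_pwDl// (le_trans (ltW x0))// ltW.
    + move=> y; rewrite in_itv/= => /andP[xy y1].
      rewrite -EFinD lee_fin -mulrDl ler_wpM2r ?wgt_ge0//.
      by rewrite {1}/phip ge_max addr_ge0 ?phip_ge0// hD// (le_lt_trans hx).
  - by move=> y _; rewrite lee_fin phip_wgt_ge0.
  - by apply/measurable_EFinP; apply: measurable_phip_wgt => //; exact: ltW.
  - by move=> y _; rewrite lee_fin mulr_ge0 ?wgt_ge0.
  - apply/measurable_EFinP; apply: measurable_funM; first exact: measurable_cst.
    apply: measurable_itv_oo => y /andP[xy y1].
    by apply: continuous_wgt; rewrite ltr_pwDl// (le_trans (ltW x0))// ltW.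
rewrite (integral_kwgt D false true (ltW x0) x1).
rewrite ge0_muleDr ?Up_ge0//; last first.
  by rewrite lee_fin mulr_ge0// subr_ge0 lef_pV2 ?posrE ?addr_gt0// lerD2l ltW.
apply: leeD; first by apply: Up_le_ufun; rewrite // x0 ltW.
rewrite -EFinM lee_fin.
rewrite mulrCA ler_piMr// mulrBr divff ?gt_eqF// gerBl.
by rewrite mulr_ge0 ?invr_ge0// ltW.
Qed.

End ufun_integral.

(** * Continuity, monotonicity and upper bounds for u *)

Section ufun_estimates.
Variable R : realType.
Implicit Types a x y z c q s : R.
Local Notation mu := (@lebesgue_measure R).

(** Young's inequality for the product z * 1 with exponents r and r / (r - 1). *)
Lemma bernoulli_powR (r z : R) : 1 <= r -> 0 <= z -> 1 - z `^ r <= r * (1 - z).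
Proof.
rewrite le_eqVlt => /predU1P[<- z0|r1 z0]; first by rewrite powRr1// mul1r.
have r0 : 0 < r by rewrite (lt_trans ltr01).
have ri1 : r^-1 < 1 by rewrite invf_lt1.
have := @conjugate_powR R z 1 r (1 - r^-1)^-1 z0 ler01 r0.
rewrite invr_gt0 subr_gt0 invrK => /(_ ri1).
rewrite addrC subrK mulr1 powR1 => /(_ erefl).
rewrite -(ler_pM2l r0) mulrDr mulrCA divff ?gt_eqF// !mulr1 mul1r.
by rewrite mulrBr divff ?gt_eqF//; lra.
Qed.

Lemma ln2_le1 : ln 2 <= 1 :> R.
Proof. by have := @le_ln1Dx R 1; rewrite -[1 + 1]/(2%:R); apply; lra. Qed.

(** Quantitative left continuity. For y above [xhalf a'] one has - ln y <= 1 / a', which controls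
    the change of a ln y; the Bernoulli inequality gives 1 - y^a <= (a / a') (1 - y^a'). *)
Lemma ufun_left a a' : 0 < a' -> a' <= a ->
  (ufun a'%:E <= ufun a%:E + (ln (a / a') + (a / a' - 1))%:E)%E.
Proof.
move=> a'0 aa'; have a0 := lt_le_trans a'0 aa'.
have r1 : 1 <= a / a' by rewrite ler_pdivlMr// mul1r.
apply: ufun_le_add => //; first by rewrite addr_ge0 ?ln_ge0 ?subr_ge0.
move=> y hy y1; have /andP[h0 h1] := xhalf_itv a'0.
have y0 := lt_trans h0 hy; have y01 : 0 < y < 1 by rewrite y0.
have /andP[ya0 ya1] := powR_itv01 a0 y01.
have /andP[yb0 yb1] := powR_itv01 a'0 y01.
apply: (@le_trans _ _ (phi a y + (ln (a / a') + (a / a' - 1)))); last first.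
  by rewrite lerD2r /phip le_max lexx orbT.
have l1 : (a - a') * - ln y <= a / a' - 1.
  have : - ln y <= a'^-1.
    have : ln (xhalf a') <= ln y by rewrite ler_ln ?posrE ?(ltW hy).
    rewrite /xhalf ln_powR mulNr lerNl => h; apply: le_trans h _.
    by rewrite ler_piMr ?ln2_le1// invr_ge0 ltW.
  move=> /(ler_wpM2l _) h; apply: le_trans (h (a - a') _) _; first by rewrite subr_ge0.
  by rewrite mulrBl divff ?gt_eqF.
have l2 : ln (1 - y `^ a) <= ln (a / a') + ln (1 - y `^ a').
  rewrite -lnM ?posrE ?subr_gt0 ?divr_gt0// ler_ln ?posrE ?mulr_gt0 ?subr_gt0 ?divr_gt0 ?invr_gt0//.
  have := @bernoulli_powR (a / a') (y `^ a') r1 (ltW yb0).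
  by rewrite -powRrM mulrCA divff ?gt_eqF// mulr1.
by rewrite /phi; move: l1 l2; rewrite mulrN mulrBl; lra.
Qed.

Lemma ufun_nincr a a' : 0 < a -> a <= a' -> (ufun a'%:E <= ufun a%:E)%E.
Proof.
move=> a0 aa'; have a'0 := lt_le_trans a0 aa'.
rewrite -[leRHS]adde0; apply: (ufun_le_add a0 a'0 (lexx 0)) => y hy y1.
have /andP[h0 h1] := xhalf_itv a'0.
have y0 := lt_trans h0 hy; have y01 : 0 < y < 1 by rewrite y0.
have /andP[ya0 ya1] := powR_itv01 a0 y01.
have /andP[yb0 yb1] := powR_itv01 a'0 y01.
rewrite addr0; apply: (@le_trans _ _ (phi a y)); last by rewrite /phip le_max lexx orbT.
apply: lerB; first by apply: ler_wnM2r => //; apply/ln_le0/ltW.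
rewrite ler_ln ?posrE ?subr_gt0// lerD2l lerN2.
by apply: ger_powR => //; rewrite y0 ltW.
Qed.

(* Integration by parts against the antiderivative 1/(1 + y) - 1/2 of the
   weight, which vanishes at 1: with y = exp (- s / a), the integral of
   (phi - c) / (1 + y)^2 over the set where phi > c is half the integral over
   [0, s0] of the function bounded by P'. *)
Lemma ufun_le_poly a q (P : {poly R}) :
  let s0 := ln (1 + q) in
  0 < a -> 0 < q <= 1 ->
  (forall s, 0 < s <= s0 ->
     (1 - expR (- (s / a))) / ((1 + expR (- (s / a))) * (1 - expR (- s))) <= P^`().[s]) ->
  (forall s, 0 <= s <= s0 -> 0 <= P.[s]) ->
  P.[s0] <= - ln q ->
  (ufun a%:E <= (- ln q)%:E)%E.
Proof.
move=> s0 a0 /andP[q0 q1] hP P0 Pc; set c := - ln q.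
have c0 : 0 <= c by rewrite oppr_ge0 ln_le0.
have s00 : 0 < s0 by rewrite ln_gt0// ltrDl.
(* The point where [phi] takes the value c: there y^a = 1 / (1 + q), hence y^a / (1 - y^a) = 1 /
   q. *)
pose x0 := expR (- (s0 / a)).
have x00 : 0 < x0 by exact: expR_gt0.
have x01 : x0 < 1 by rewrite expR_lt1 oppr_lt0 divr_gt0.
have x0a : x0 `^ a = (1 + q)^-1.
  by rewrite -expRM mulNr divfK ?gt_eqF// expRN lnK// posrE addr_gt0.
have phix0 : phi a x0 = c.
  rewrite -phiE ?x00// x0a /c -lnV//; congr ln.
  have q10 : 1 + q != 0 by rewrite gt_eqF// addr_gt0.
  have -> : 1 - (1 + q)^-1 = q / (1 + q) by field.
  by field; rewrite q10 gt_eqF.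
pose w2 y := (1 + y)^-1 - 2^-1.
pose s y := - (a * ln y).
(* At [x0] the boundary term vanishes and [F] equals - P.[s0] / 2; further right both terms are
   nonpositive. So the increments from [x0] are at most c / 2, and no limit at 1 is needed. *)
pose F y := - ((phi a y - c) * w2 y) - 2^-1 * P.[s y].
pose f y := (phi a y - c) * wgt y - a / (y * (1 - y `^ a)) * w2 y
            + 2^-1 * (P^`().[s y] * (a / y)).
have dom y : x0 <= y < 1 -> [/\ 0 < y < 1, 0 < y `^ a < 1, 0 < 1 + y & 0 < s y <= s0].
  move=> /andP[xy y1]; have y0 := lt_le_trans x00 xy.
  have y01 : 0 < y < 1 by rewrite y0.
  split => //; [exact: powR_itv01|by rewrite addr_gt0|].
  have lnx : - (s0 / a) <= ln y.
    by rewrite -[leLHS]expRK ler_ln ?posrE ?expR_gt0.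
  rewrite /s oppr_gt0 pmulr_rlt0// ln_lt0 ?y0//= lerNl.
  by move: (ler_wpM2l (ltW a0) lnx); rewrite mulrN mulrCA divff ?gt_eqF// mulr1.
have sE y : 0 < y -> expR (- (s y / a)) = y.
  by move=> y0; rewrite /s mulNr opprK mulrAC divff ?gt_eqF// mul1r lnK.
have ds y : 0 < y -> is_derive y 1 s (- (a * y^-1)).
  by move=> y0; apply: is_derive_eq (is_deriveN (is_deriveZ a (is_derive1_ln y0))) _.
have dw y : 0 < 1 + y -> is_derive y 1 w2 (- wgt y).
  move=> y0; have d := is_deriveN (is_derive_wgt y0).
  have d' := is_deriveB d (is_derive_cst (2^-1 : R) y 1).
  rewrite subr0 in d'; rewrite (_ : w2 = - (fun x : R => - (1 + x)^-1) - cst 2^-1)//.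
  by apply/funext => x; rewrite /w2 -[RHS]/(- - (1 + x)^-1 - 2^-1) opprK.
have dF y : x0 <= y < 1 -> is_derive y 1 F (f y).
  move=> /dom[/andP[y0 y1] ya01 y10 _].
  have dphi : is_derive y 1 (phi a) (a / (y * (1 - y `^ a))).
    by apply: is_derive_phi; rewrite ?y0.
  have dphic := is_deriveB dphi (is_derive_cst c y 1).
  have d1 := is_deriveM dphic (dw y y10).
  have d2 := is_derive1_comp (is_derive_poly P (s y)) (ds y y0).
  have d3 := is_deriveB (is_deriveN d1) (is_deriveZ 2^-1 d2).
  apply: is_derive_eq d3 _.
  rewrite -[(phi a - cst c) y]/(phi a y - c) /f subr0.
  by rewrite /GRing.scale/=; ring.
have cP (p : {poly R}) x : {for x, continuous (horner p)}.
  exact: is_derive_continuous (is_derive_poly p x).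
have cf y : x0 <= y < 1 -> {for y, continuous f}.
  move=> /dom[/andP[y0 y1] /andP[_ ya1] y10 _].
  have cy : {for y, continuous (fun x : R => x)} by exact: cvg_id.
  have ca : {for y, continuous (fun x : R => x `^ a)}.
    by apply: is_derive_continuous; exact: is_derive1_powR.
  apply: cvgD; first apply: cvgB.
  - apply: cvgM; last exact: continuous_wgt.
    apply: cvgB; last exact: cvg_cst.
    by apply: continuous_phi => //; rewrite y0.
  - apply: cvgM; last exact: is_derive_continuous (dw y y10).
    apply: cvgM; first exact: cvg_cst.
    apply: cvgV; first by rewrite gt_eqF// mulr_gt0// subr_gt0.
    by apply: cvgM => //; apply: cvgB; [exact: cvg_cst|exact: ca].
  - apply: cvgM; first exact: cvg_cst.
    apply: cvgM; last first.
      by apply: cvgM; [exact: cvg_cst|apply: cvgV => //; rewrite gt_eqF].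
    apply: (@continuous_comp _ _ _ s (horner P^`())); last exact: cP.
    exact: is_derive_continuous (ds y y0).
have phic y : x0 <= y < 1 -> c <= phi a y.
  by move=> /andP[xy y1]; rewrite -phix0 phi_le.
have w2_ge0 y : x0 <= y < 1 -> 0 <= w2 y.
  move=> /[dup]/dom[_ _ y10 _] /andP[_ y1]; rewrite subr_ge0 lef_pV2 ?posrE//.
  by rewrite -[2%:R]/(1 + 1) lerD2l ltW.
pose g y := Num.max 0 (phi a y - c) * wgt y.
have gf y : x0 <= y < 1 -> g y <= f y.
  move=> xy1; have [y01 ya01 y10 /hP sy] := dom y xy1.
  have /andP[y0 y1] := y01; have /andP[ya0 ya1] := ya01.
  rewrite /g max_r ?subr_ge0 ?phic// /f.
  suff : a / (y * (1 - y `^ a)) * w2 y <= 2^-1 * (P^`().[s y] * (a / y)).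
    by move: (_ * wgt y) => A; lra.
  move: sy; rewrite sE//.
  have -> : expR (- s y) = y `^ a by rewrite /s opprK /powR gt_eqF.
  move=> /(ler_wpM2r (_ : 0 <= a / y)) sy.
  rewrite -ler_pdivrMl ?invr_gt0// invrK; apply: le_trans (sy _); last by rewrite ltW ?divr_gt0.
  rewrite le_eqVlt; apply/orP; left; apply/eqP; rewrite /w2; field.
  by rewrite !gt_eqF ?mulr_gt0 ?subr_gt0.
have g0 y : 0 <= g y by rewrite mulr_ge0 ?wgt_ge0// le_max lexx.
have intf : (\int[mu]_(y in `]x0, 1%R[) (f y)%:E <= (c / 2)%:E)%E.
  apply: (@integral_oo_le_antiderivative _ F) => //.
  - by rewrite divr_ge0.
  - by move=> y xy1; apply: le_trans (gf y xy1).
  - move=> z /andP[xz z1]; have xz1 : x0 <= z < 1 by rewrite ltW.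
    have [_ _ _ /andP[sz0 sz1]] := dom z xz1.
    have Fz : F z <= 0.
      have A0 : 0 <= (phi a z - c) * w2 z by apply: mulr_ge0; [rewrite subr_ge0 phic|exact: w2_ge0].
      have B0 : 0 <= 2^-1 * P.[s z] by apply: mulr_ge0 => //; apply: P0; rewrite ltW.
      by rewrite /F; move: A0 B0; move: (_ * w2 z) (2^-1 * _) => A B; lra.
    have sx0 : s x0 = s0 by rewrite /s /x0 expRK mulrN opprK mulrCA divff ?mulr1// gt_eqF.
    rewrite -[c / 2]add0r; apply: lerD => //.
    rewrite /F phix0 subrr mul0r oppr0 sub0r opprK sx0 mulrC.
    by rewrite ler_pdivrMr// mulfVK.
have mg x : 0 <= x -> measurable_fun `]x, 1[ g.
  move=> x0'; apply: measurable_funM.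
    apply: measurable_maxr; first exact: measurable_cst.
    apply: measurable_itv_oo => y /andP[xy y1]; apply: cvgB; last exact: cvg_cst.
    by apply: continuous_phi => //; rewrite y1 (le_lt_trans x0').
  apply: measurable_itv_oo => y /andP[xy y1].
  by apply: continuous_wgt; rewrite ltr_pwDl// (le_trans x0')// ltW.
have intg : (\int[mu]_(y in `]0%R, 1%R[) (g y)%:E <= (c / 2)%:E)%E.
  apply: le_trans intf.
  rewrite (@itv_bndbnd_setU _ _ (BRight 0) (BRight x0) (BLeft 1)) ?bnd_simp//; last exact: ltW.
  rewrite ge0_integral_setU//=; last 3 first.
  - rewrite -itv_bndbnd_setU ?bnd_simp//; last exact: ltW.
    by apply/measurable_EFinP; exact: mg.
  - by move=> y _; rewrite lee_fin; exact: g0.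
  - apply/disj_setPS => y /=; rewrite !in_itv/= => -[/andP[_ yz] /andP[zy _]].
    by move: (lt_le_trans zy yz); rewrite ltxx.
  rewrite integral0_eq ?add0e.
    apply: ge0_le_integral => //=.
    - by move=> y _; rewrite lee_fin; exact: g0.
    - by apply/measurable_EFinP; exact: mg (ltW x00).
    - apply/measurable_EFinP; apply: measurable_itv_oo => y /andP[xy y1].
      by apply: cf; rewrite ltW.
    - by move=> y; rewrite in_itv/= => /andP[xy y1]; rewrite lee_fin gf// ltW.
  move=> y /=; rewrite in_itv/= => /andP[y0 yx].
  by rewrite /g max_l ?mul0r// subr_le0 -phix0 phi_le.
apply: ufun_le => // x /andP[hx].
have /andP[h0 h1] := xhalf_itv a0.
have xx0 : 0 < x by rewrite (lt_le_trans h0).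
have pos : 0 < 1 + x by rewrite addr_gt0.
rewrite le_eqVlt => /predU1P[->|x1].
  by rewrite /Up set_itvoo0 integral_set0 mule0 lee_fin.
(* Here max(0, phi) <= c + max(0, phi - c). The bound c / 2 for the second part cancels the - c / 2
   left by the first, so that multiplication by 1 + x gives c for every x. *)
have : (Up a x <= (c * ((1 + x)^-1 - (1 + 1)^-1))%:E + (c / 2)%:E)%E.
  apply: (@le_trans _ _ (\int[mu]_(y in `]x, 1%R[) ((c * wgt y)%:E + (g y)%:E))%E).
    apply: ge0_le_integral => //=.
    + by move=> y _; rewrite lee_fin phip_wgt_ge0.
    + by apply/measurable_EFinP; apply: measurable_phip_wgt => //; exact: ltW.
    + apply: emeasurable_funD; apply/measurable_EFinP; last exact: mg (ltW xx0).
      apply: measurable_funM; first exact: measurable_cst.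
      apply: measurable_itv_oo => y /andP[xy y1].
      by apply: continuous_wgt; rewrite ltr_pwDl// (le_trans (ltW xx0))// ltW.
    + move=> y _; rewrite -EFinD lee_fin -mulrDl ler_wpM2r ?wgt_ge0//.
      rewrite /phip ge_max; apply/andP; split.
        by rewrite addr_ge0// le_max lexx.
      by rewrite -lerBlDl le_max lexx orbT.
  rewrite ge0_integralD//=; last 4 first.
  - by move=> y _; rewrite lee_fin mulr_ge0 ?wgt_ge0.
  - apply/measurable_EFinP; apply: measurable_funM; first exact: measurable_cst.
    apply: measurable_itv_oo => y /andP[xy y1].
    by apply: continuous_wgt; rewrite ltr_pwDl// (le_trans (ltW xx0))// ltW.
  - by move=> y _; rewrite lee_fin; exact: g0.
  - by apply/measurable_EFinP; exact: mg (ltW xx0).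
  rewrite (integral_kwgt c false true (ltW xx0) x1) leeD2l//.
  apply: le_trans intg; apply: ge0_subset_integral => //=.
  - by apply/measurable_EFinP; exact: mg.
  - by move=> y _; rewrite lee_fin; exact: g0.
  - by apply: subset_itvr; rewrite bnd_simp ltW.
have := lexx (1 + x)%:E.
move=> _ /(lee_wpmul2l (_ : 0 <= (1 + x)%:E)%E) h.
apply: le_trans (h _) _; first by rewrite lee_fin ltW.
rewrite -EFinD -EFinM lee_fin le_eqVlt; apply/orP; left; apply/eqP.
by field; rewrite gt_eqF.
Qed.

End ufun_estimates.

(** * The function v *)

Section log_series.
Variable R : realType.
Implicit Types (F f : R -> R) (x y z a : R).

Lemma is_derive_nondecreasing F f x y : x <= y ->
  (forall t, x <= t <= y -> is_derive t 1 F (f t)) ->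
  (forall t, x <= t <= y -> 0 <= f t) -> F x <= F y.
Proof.
move=> xy dF f0.
have [c /itvP cxy e] : exists2 c, c \in `[x, y] & F y - F x = f c * (y - x).
  apply: MVT_segment => //.
    by move=> t; rewrite in_itv/= => /andP[xt ty]; apply: dF; rewrite !ltW.
  apply: continuous_in_subspaceT => t; rewrite inE/= in_itv/= => /dF.
  exact: is_derive_continuous.
by rewrite -subr_ge0 e mulr_ge0 ?subr_ge0// f0// !cxy.
Qed.

Definition logpoly (n : nat) : {poly R} := \sum_(k < n) (k.+1%:R)^-1 *: 'X^(k.+1).

Lemma horner_logpoly n z : (logpoly n).[z] = \sum_(k < n) z ^+ k.+1 / k.+1%:R.
Proof.
rewrite /logpoly horner_sum; apply: eq_bigr => k _.
by rewrite hornerZ hornerXn mulrC.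
Qed.

Lemma deriv_logpoly n z : z != 1 -> (logpoly n)^`().[z] = (1 - z ^+ n) / (1 - z).
Proof.
move=> z1; rewrite /logpoly raddf_sum horner_sum.
have z10 : 1 - z != 0 by rewrite subr_eq0 eq_sym.
apply: (@mulIf _ (1 - z)) => //; rewrite divfK//.
rewrite -[1 - z ^+ n]opprB subrX1 mulrC -mulNr opprB; congr (_ * _).
apply: eq_bigr => k _; rewrite /= derivZ derivXn hornerZ hornerMn hornerXn/=.
by rewrite mulrnAr -mulrnAl -[_^-1 *+ _]mulr_natr mulVf ?mul1r// pnatr_eq0.
Qed.

Lemma is_derive_ln1B z : z < 1 -> is_derive z 1 (fun x : R => ln (1 - x)) (- (1 - z)^-1).
Proof.
move=> z1; have p0 : 0 < (cst 1 - id) z :> R by rewrite subr_gt0.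
have d := is_derive1_comp (is_derive1_ln p0)
  (is_deriveB (is_derive_cst (1 : R) z 1) (is_derive_id z (1 : R))).
by apply: is_derive_eq d _; rewrite sub0r mulrN1.
Qed.

Lemma logpoly_le n z : 0 <= z < 1 -> (logpoly n).[z] <= - ln (1 - z).
Proof.
move=> /andP[z0 z1].
have dF (t : R) : 0 <= t <= z ->
    is_derive t 1 (- (fun x : R => ln (1 - x)) - horner (logpoly n)) (t ^+ n / (1 - t)).
  move=> /andP[t0 tz]; have t1 := le_lt_trans tz z1.
  have d := is_deriveB (is_deriveN (is_derive_ln1B t1)) (is_derive_poly (logpoly n) t).
  apply: is_derive_eq d _; rewrite deriv_logpoly ?lt_eqF//.
  by field; rewrite subr_eq0 gt_eqF.
have := is_derive_nondecreasing z0 dF.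
rewrite -[(_ - _) 0]/(- ln (1 - 0) - (logpoly n).[0]).
rewrite -[(_ - _) z]/(- ln (1 - z) - (logpoly n).[z]).
rewrite subr0 ln1 oppr0 horner_logpoly big1 ?subr0; last first.
  by move=> k _; rewrite expr0n mul0r.
move=> h; rewrite -subr_ge0; apply: h => t /andP[t0 tz].
by rewrite divr_ge0 ?exprn_ge0// subr_ge0 ltW// (le_lt_trans tz).
Qed.

Lemma le_logpoly n z : 0 <= z < 1 ->
  - ln (1 - z) <= (logpoly n).[z] + z ^+ n.+1 / (n.+1%:R * (1 - z)).
Proof.
move=> /andP[z0 z1]; have n1 : n.+1%:R != 0 :> R by rewrite pnatr_eq0.
pose E := (fun x : R => ln (1 - x)) + horner (logpoly n)
  + ((n.+1%:R)^-1 \*: ((fun x : R => x ^+ n.+1) * (fun x : R => ((cst 1 - @id R) x)^-1))).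
have dF (t : R) : 0 <= t <= z ->
    is_derive t 1 E (t ^+ n.+1 / (n.+1%:R * (1 - t) ^+ 2)).
  move=> /andP[t0 tz]; have t1 := le_lt_trans tz z1.
  have t10 : 1 - t != 0 by rewrite subr_eq0 gt_eqF.
  have dX : is_derive t 1 (fun x : R => x ^+ n.+1) (n.+1%:R * t ^+ n * 1).
    have := is_deriveX n.+1 (is_derive_id t (1 : R)).
    by rewrite (_ : id ^+ n.+1 = fun x : R => x ^+ n.+1)//; apply/funext => x; rewrite exprfctE.
  have dV := is_deriveV (t10 : (cst 1 - id) t != 0)
    (is_deriveB (is_derive_cst (1 : R) t 1) (is_derive_id t (1 : R))).
  have d := is_deriveD (is_deriveD (is_derive_ln1B t1) (is_derive_poly (logpoly n) t))
    (is_deriveZ (n.+1%:R)^-1 (is_deriveM dX dV)).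
  apply: is_derive_eq d _; rewrite deriv_logpoly ?lt_eqF//.
  rewrite /GRing.scale/= -[(cst 1 - id) t]/(1 - t) exprS.
  by field; rewrite t10 nat1r n1.
have := is_derive_nondecreasing z0 dF.
rewrite -[E 0]/(ln (1 - 0) + (logpoly n).[0] + (n.+1%:R)^-1 * (0 ^+ n.+1 * (1 - 0)^-1)).
rewrite -[E z]/(ln (1 - z) + (logpoly n).[z] + (n.+1%:R)^-1 * (z ^+ n.+1 * (1 - z)^-1)).
rewrite subr0 ln1 expr0n mul0r mulr0 add0r addr0 horner_logpoly big1; last first.
  by move=> k _; rewrite expr0n mul0r.
rewrite invfM => h; rewrite -subr_ge0 opprK (mulrCA (z ^+ _)) addrC addrA.
apply: h => t /andP[t0 tz].
by rewrite divr_ge0 ?exprn_ge0// mulr_ge0// sqr_ge0.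
Qed.

Lemma nneseries_log z : 0 <= z < 1 ->
  (\sum_(k <oo) (z ^+ k.+1 / k.+1%:R)%:E = (- ln (1 - z))%:E)%E.
Proof.
move=> z01; have /andP[z0 z1] := z01.
apply: cvg_lim => //.
have -> : (fun n => \sum_(0 <= k < n) (z ^+ k.+1 / k.+1%:R)%:E)%E =
    (fun n => ((logpoly n).[z])%:E).
  by apply/funext => n; rewrite sumEFin horner_logpoly big_mkord.
apply: cvg_EFin; first by near=> n.
rewrite [X in X @ _ --> _](_ : _ = (fun n => (logpoly n).[z]))//.
have h n : - ln (1 - z) - z ^+ n * (1 - z)^-1 <= (logpoly n).[z] <= - ln (1 - z).
  rewrite logpoly_le// andbT lerBlDr (le_trans (le_logpoly n z01))// lerD2l.
  rewrite invfM mulrA ler_wpM2r ?invr_ge0 ?subr_ge0 ?(ltW z1)//.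
  rewrite ler_pdivrMr ?ltr0n// exprS mulrC ler_wpM2l ?exprn_ge0//.
  by rewrite (le_trans (ltW z1))// ler1n.
apply: (@squeeze_cvgr _ _ _ _ (fun n => - ln (1 - z) - z ^+ n * (1 - z)^-1)
  (fun=> - ln (1 - z))).
- by near=> n; exact: h.
- rewrite -[X in _ --> X]subr0; apply: cvgB; first exact: cvg_cst.
  rewrite -[X in _ --> X](mul0r (1 - z)^-1); apply: cvgM; last exact: cvg_cst.
  by apply: cvg_expr; rewrite ger0_norm.
- exact: cvg_cst.
Unshelve. all: by end_near. Qed.

End log_series.

(** * Series, continuity and Riemann sums for v *)

Section vfun.
Variable R : realType.
Implicit Types (a x y z r : R).
Local Notation mu := (@lebesgue_measure R).

Lemma powRN_cvgy0 r : 0 < r -> x `^ (- r) @[x --> +oo] --> (0 : R).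
Proof.
move=> r0; under eq_fun do rewrite powRN.
apply/gtr0_cvgV0; first by near=> x; rewrite powR_gt0.
apply/cvgryPge => A; near=> x.
have A0 : 0 <= Num.max 1 A by rewrite le_max ler01.
apply: (@le_trans _ _ (Num.max 1 A)); first by rewrite le_max lexx orbT.
rewrite -[leLHS](@powRr1 _ _ A0) -(mulVf (lt0r_neq0 r0)) powRrM.
apply: ge0_ler_powR; rewrite ?nnegrE ?powR_ge0 ?(ltW r0)//.
Unshelve. all: by end_near. Qed.

Lemma integral_powRN r : 1 < r ->
  (\int[mu]_(x in `]1%R, +oo[) (x `^ (- r))%:E = ((r - 1)^-1)%:E)%E.
Proof.
move=> r1; pose f x := x `^ (- r).
pose F := (1 - r)^-1 \*: (fun x : R => x `^ (1 - r)).
have r10 : 1 - r != 0 by rewrite subr_eq0 lt_eqF.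
have dF x : 1 <= x -> is_derive x 1 F (f x).
  move=> x1; have x0 : 0 < x by rewrite (lt_le_trans ltr01).
  apply: is_derive_eq (is_deriveZ (1 - r)^-1 (is_derive1_powR (1 - r) x0)) _.
  by rewrite /GRing.scale/= mulrA mulVf// mul1r addrAC subrr add0r.
have cf x : 1 <= x -> {for x, continuous f}.
  move=> x1; apply: is_derive_continuous (is_derive1_powR (- r) _).
  by rewrite (lt_le_trans ltr01).
rewrite integral_itv_obnd_cbnd; last first.
  apply/measurable_EFinP; apply: open_continuous_measurable_fun.
    exact: interval_open.
  by move=> x; rewrite inE/= in_itv/= andbT => x1; apply: cf; exact: ltW.
have F0 : (fun x : R => x `^ (1 - r)) x @[x --> +oo] --> (0 : R).
  have r0 : 0 < r - 1 by rewrite subr_gt0.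
  by have := powRN_cvgy0 r0; rewrite opprB.
rewrite (@ge0_continuous_FTC2y _ f F 1 0).
- rewrite -EFinB sub0r -[F 1]/((1 - r)^-1 * 1 `^ (1 - r)) powR1 mulr1.
  by rewrite -invrN opprB.
- by move=> x _; exact: powR_ge0.
- by apply: continuous_in_subspaceT => x; rewrite inE/= in_itv/= andbT => /cf.
- rewrite -[X in _ --> X](mulr0 (1 - r)^-1); apply: cvgM; first exact: cvg_cst.
  exact: F0.
- by move=> x /ltW/dF[].
- by apply: cvg_at_right_filter; apply: is_derive_continuous (dF 1 _).
- by move=> x; rewrite in_itv/= andbT => /ltW/dF dFx; rewrite derive1E; apply: derive_val.
Qed.

Lemma measurable_ln_powRN a D : measurable D ->
  measurable_fun D (fun x => - ln (1 - x `^ (- a))).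
Proof.
move=> mD; apply: measurable_funTS; apply: measurableT_comp => //.
apply: measurableT_comp; first exact: measurable_ln.
by apply: measurable_funB => //; exact: measurable_powR.
Qed.

Lemma powRN_itv01 a x : 0 < a -> 1 < x -> 0 < x `^ (- a) < 1.
Proof.
move=> a0 x1; have x0 : 0 < x by rewrite (lt_trans ltr01).
rewrite powR_gt0//= powRN invf_lt1 ?powR_gt0// -[ltLHS](powRr0 x).
by rewrite /powR gt_eqF// ltr_expR mul0r mulr_gt0// ln_gt0.
Qed.

Lemma vfunE a : 1 < a ->
  vfun a%:E = (\int[mu]_(x in `]1%R, +oo[) (- ln (1 - x `^ (- a)))%:E)%E.
Proof.
move=> a1; rewrite /vfun a1; apply: eq_integral => x; rewrite inE/= in_itv/= andbT.
move=> /(powRN_itv01 (lt_trans ltr01 a1))/andP[_ x1].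
by rewrite lnV// posrE subr_gt0.
Qed.

(** The integral over ]1, +oo[ of x^(- (k + 1) a) / (k + 1), a term of the logarithm series. *)
Definition vcoef a (k : nat) : R := (k.+1%:R * (k.+1%:R * a - 1))^-1.

Lemma vcoef_gt0 a k : 1 < a -> 0 < vcoef a k.
Proof.
move=> a1; rewrite invr_gt0 mulr_gt0 ?ltr0n// subr_gt0.
by rewrite (lt_le_trans a1)// ler_peMl ?(ltW (lt_trans ltr01 a1))// ler1n.
Qed.

Lemma vfun_series a : 1 < a -> (vfun a%:E = \sum_(k <oo) (vcoef a k)%:E)%E.
Proof.
move=> a1; have a0 := lt_trans ltr01 a1; rewrite vfunE//.
transitivity (\int[mu]_(x in `]1%R, +oo[)
    (\sum_(k <oo) ((x `^ (- a)) ^+ k.+1 / k.+1%:R)%:E))%E.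
  apply: eq_integral => x; rewrite inE/= in_itv/= andbT => /(powRN_itv01 a0)/andP[x0 x1].
  by rewrite nneseries_log// ltW.
have pE x k : 1 < x -> (x `^ (- a)) ^+ k.+1 = x `^ (- (k.+1%:R * a)).
  by move=> x1; rewrite -powR_mulrn ?powR_ge0// -powRrM mulNr mulrC.
rewrite integral_nneseries//=; last 2 first.
- move=> k; apply/measurable_EFinP; apply: measurable_funM => //.
  apply: measurable_funX; apply: measurable_funTS.
  exact: measurable_powR.
- by move=> k x _; rewrite lee_fin divr_ge0 ?exprn_ge0 ?powR_ge0.
apply: eq_eseriesr => k _.
have r1 : 1 < k.+1%:R * a by rewrite (lt_le_trans a1)// ler_peMl ?(ltW a0)// ler1n.
transitivity (\int[mu]_(x in `]1%R, +oo[)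
    ((k.+1%:R^-1)%:E * (x `^ (- (k.+1%:R * a)))%:E))%E.
  apply: eq_integral => x; rewrite inE/= in_itv/= andbT => x1.
  by rewrite pE// mulrC EFinM.
rewrite ge0_integralZl//=; last 2 first.
- by apply/measurable_EFinP; apply: measurable_funTS; exact: measurable_powR.
- by move=> x _; rewrite lee_fin powR_ge0.
by rewrite integral_powRN// -EFinM -invfM.
Qed.

(** Left continuity of v, termwise: (n a - 1) / (n a' - 1) is nonincreasing in n, hence at most its
    value at n = 1. *)
Lemma vfun_ratio a a' : 1 < a' -> a' <= a ->
  (vfun a'%:E <= ((a - 1) / (a' - 1))%:E * vfun a%:E)%E.
Proof.
move=> a'1 aa'; have a1 := lt_le_trans a'1 aa'.
rewrite !vfun_series// -nneseriesZl; last by move=> k _; rewrite lee_fin ltW// vcoef_gt0.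
apply: lee_nneseries => k _; first by rewrite lee_fin ltW// vcoef_gt0.
rewrite -EFinM lee_fin /vcoef.
have p1 : 0 < a - 1 by rewrite subr_gt0.
have p2 : 0 < a' - 1 by rewrite subr_gt0.
have n0 : 0 < k.+1%:R :> R by rewrite ltr0n.
have n1 : 1 <= k.+1%:R :> R by rewrite ler1n.
move: k.+1%:R n0 n1 => n n0 n1.
have q1 : 0 < n * a - 1 by nra.
have q2 : 0 < n * a' - 1 by nra.
rewrite !invfM [leRHS]mulrCA ler_wpM2l ?invr_ge0 ?(ltW n0)//.
rewrite -[leLHS]mul1r ler_pdivrMr// mulrAC ler_pdivlMr// mulrAC ler_pdivlMr//.
nra.
Qed.

Lemma vfun_nincr a a' : 1 < a -> a <= a' -> (vfun a'%:E <= vfun a%:E)%E.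
Proof.
move=> a1 aa'; have a'1 := lt_le_trans a1 aa'; rewrite !vfun_series//.
apply: lee_nneseries => k _; first by rewrite lee_fin ltW// vcoef_gt0.
have := vcoef_gt0 k a1; have := vcoef_gt0 k a'1; rewrite !invr_gt0 => h h'.
by rewrite lee_fin lef_pV2 ?posrE// ler_wpM2l// lerD2r ler_wpM2l.
Qed.

(* The terms of the series are bounded by the differences of the sequence
   2 / (a (2 k + 1) - 1), because (2 n a - 1)^2 - 1 >= (2 n a - 1)^2 - a^2. *)
Lemma vfun_le_tail a K : 1 < a ->
  (vfun a%:E <= (\sum_(k < K) vcoef a k + 2 / (a * K.*2.+1%:R - 1))%:E)%E.
Proof.
move=> a1; rewrite vfun_series//.
pose T k : R := 2 / (a * k.*2.+1%:R - 1).
have Tp k : 0 < a * k.*2.+1%:R - 1.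
  rewrite subr_gt0 (lt_le_trans a1)// ler_peMr ?ler1n//.
  exact: ltW (lt_trans ltr01 a1).
have T0 k : 0 <= T k by rewrite divr_ge0// ltW.
have step k : vcoef a k + T k.+1 <= T k.
  have := Tp k; have := Tp k.+1; have := vcoef_gt0 k a1; rewrite invr_gt0 /vcoef /T.
  have -> : k.+1.*2.+1%:R = 2 * k.+1%:R + 1 :> R.
    by rewrite -natr1 -muln2 natrM mulrC.
  have -> : k.*2.+1%:R = 2 * k.+1%:R - 1 :> R.
    by rewrite -(natr1 k) -(natr1 k.*2) -muln2 natrM; ring.
  have n1 : 1 <= k.+1%:R :> R by rewrite ler1n.
  move: k.+1%:R n1 => n n1 h0 h1 h2.
  have n0 : 0 < n by rewrite (lt_le_trans ltr01).
  rewrite -[_^-1]mul1r addf_div ?gt_eqF// ler_pdivrMr; last exact: mulr_gt0.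
  by rewrite mulrAC ler_pdivlMr//; nra.
have dec n m : \sum_(k < n + m) vcoef a k + T (n + m)%N <= \sum_(k < n) vcoef a k + T n.
  elim: m => [|m ih]; first by rewrite addn0.
  rewrite addnS big_ord_recr/= -addrA; apply: le_trans ih.
  by rewrite lerD2l.
have cvg : cvgn (fun n => \sum_(0 <= k < n) (vcoef a k)%:E)%E.
  by apply: is_cvg_nneseries => k _ _; rewrite lee_fin ltW// vcoef_gt0.
apply: lime_le => //.
near=> n; rewrite sumEFin big_mkord lee_fin.
have nK : (K <= n)%N by near: n; exact: nbhs_infty_ge.
by have := dec K (n - K)%N; rewrite subnKC//; apply: le_trans; rewrite lerDl.
Unshelve. all: by end_near. Qed.

(* The integral of the decreasing integrand is at least its lower Riemann sum
   over the points 1 + 2 l / N = (N + 2 l) / N. *)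
Lemma sum_log_le_vfun a v (N j : nat) : 1 < a -> (0 < N)%N -> (vfun a%:E <= v%:E)%E ->
  \sum_(l < j) - ln (1 - (N%:R / (N + l.+1.*2)%:R) `^ a) <= N%:R / 2 * v.
Proof.
move=> a1 N0 va; have a0 := lt_trans ltr01 a1.
have Np : 0 < N%:R :> R by rewrite ltr0n.
pose h x := - ln (1 - x `^ (- a)).
pose X l : R := (N + l.*2)%:R / N%:R.
have X1 l : 1 <= X l by rewrite ler_pdivlMr// mul1r ler_nat leq_addr.
have XS l : X l.+1 = X l + 2 / N%:R.
  by rewrite /X -mulrDl -natrD; congr (_%:R / _); rewrite doubleS; lia.
have hX l : - ln (1 - (N%:R / (N + l.*2)%:R) `^ a) = h (X l).
  rewrite /h -invf_div -/(X l); congr (- ln (1 - _)).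
  by rewrite -powR_inv1 ?(le_trans ler01 (X1 l))// -powRrM mulN1r.
have h0 x : 1 < x -> 0 <= h x.
  by move=> /(powRN_itv01 a0)/andP[x0 x1]; rewrite oppr_ge0 ln_le0// gerBl ltW.
have hdec x y : 1 < x -> x <= y -> h y <= h x.
  move=> x1 xy; have y1 := lt_le_trans x1 xy.
  have x0 := lt_trans ltr01 x1; have y0 := lt_trans ltr01 y1.
  have /andP[hx0 hx1] := powRN_itv01 a0 x1; have /andP[hy0 hy1] := powRN_itv01 a0 y1.
  rewrite lerN2 ler_ln ?posrE ?subr_gt0// lerD2l lerN2 !powRN lef_pV2 ?posrE ?powR_gt0//.
  by apply: ge0_ler_powR; rewrite ?nnegrE ?(ltW a0) ?(ltW x0) ?(ltW y0).
have H k : ((2 / N%:R * \sum_(l < k) h (X l.+1))%:E <=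
    \int[mu]_(x in `]1%R, (X k)]) (h x)%:E)%E.
  elim: k => [|k ih].
    rewrite big_ord0 mulr0; apply: integral_ge0 => x /=.
    by rewrite in_itv/= => /andP[x1 _]; rewrite lee_fin h0.
  have XX : X k <= X k.+1 by rewrite XS lerDl divr_ge0.
  rewrite (@itv_bndbnd_setU _ _ (BRight 1) (BRight (X k)) (BRight (X k.+1))) ?bnd_simp//.
  rewrite ge0_integral_setU//=; last 3 first.
  - rewrite -itv_bndbnd_setU ?bnd_simp//.
    by apply/measurable_EFinP; exact: measurable_ln_powRN.
  - move=> x /= []; rewrite in_itv/= => /andP[x1 _]; rewrite lee_fin h0//.
    exact: le_lt_trans x1.
  - apply/disj_setPS => y /=; rewrite !in_itv/= => -[/andP[_ yz] /andP[zy _]].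
    by move: (lt_le_trans zy yz); rewrite ltxx.
  rewrite big_ord_recr/= mulrDr EFinD leeD//.
  have Xk1 : 1 < X k.+1 by rewrite XS (le_lt_trans (X1 k))// ltrDl divr_gt0.
  apply: le_trans (integral_oc_ge (f := h) (g := h (X k.+1)) XX _ _ _).
  - by rewrite XS addrAC subrr add0r mulrC.
  - exact: h0.
  - exact: measurable_ln_powRN.
  - by move=> x /andP[xk xk1]; apply: hdec => //; rewrite (le_lt_trans (X1 k)).
have : ((2 / N%:R * \sum_(l < j) h (X l.+1))%:E <= v%:E)%E.
  apply: le_trans va; apply: le_trans (H j) _; rewrite vfunE//.
  apply: ge0_subset_integral => //=.
  - by apply/measurable_EFinP; exact: measurable_ln_powRN.
  - by move=> x; rewrite in_itv/= andbT => x1; rewrite lee_fin h0.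
  - by apply: subset_itvl; rewrite bnd_simp.
rewrite lee_fin => Hj; under eq_bigr do rewrite hX.
rewrite -ler_pdivrMl ?divr_gt0// invf_div; exact: Hj.
Qed.

End vfun.

(** * The bound k(1.68746) < 1 *)

Section numerics.
Variable R : realType.
Implicit Types (a x s : R).

Local Notation a0 := (1687%:R / 10%:R ^+ 3 + 46%:R / 10%:R ^+ 5 : R).

Lemma ln2_bounds :
  693%:R / 10%:R ^+ 3 + 1471%:R / 10%:R ^+ 7 <= ln (2 : R)
    <= 693%:R / 10%:R ^+ 3 + 148%:R / 10%:R ^+ 6.
Proof.
have h : 0 <= (2^-1 : R) < 1 by lra.
have e2 : 1 - 2^-1 = 2^-1 :> R by lra.
have e : - ln (1 - 2^-1) = ln 2 :> R by rewrite e2 lnV ?opprK ?posrE.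
have := logpoly_le 20 h; have := le_logpoly 20 h.
rewrite e !horner_logpoly !big_ord_recr big_ord0/= invfM e2 invrK.
lra.
Qed.

(** Blocks in units of 10^-3, 10^-6 and 10^-9 keep the [nat] literals small. *)
Definition decimal (d : nat * nat * nat) : R :=
  d.1.1%:R / 10%:R ^+ 3 + d.1.2%:R / 10%:R ^+ 6 + d.2%:R / 10%:R ^+ 9.

Lemma vcoef_le_decimal k d :
  1 <= decimal d * (k.+1%:R * (k.+1%:R * a0 - 1)) -> vcoef a0 k <= decimal d.
Proof.
move=> h; have a1 : 1 < a0 by lra.
by have := vcoef_gt0 k a1; rewrite invr_gt0 => p; rewrite -[leLHS]mul1r ler_pdivrMr.
Qed.

Lemma vfun_bound : (vfun a0%:E <= (193%:R / 10%:R ^+ 2 + 1250%:R / 10%:R ^+ 6)%:E)%E.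
Proof.
(* Upper bounds with eight decimals for the first 20 terms. With the tail bound 0.0293316 they add
   up to slightly less than 1.93125. *)
pose d : seq (nat * nat * nat) :=
  [:: (1454, 630, 90); (210, 533, 410); (82, 53, 710); (43, 479, 480);
      (26, 891, 480); (18, 265, 330); (13, 212, 570); (10, 0, 260);
      (7, 831, 820); (6, 299, 380); (5, 176, 450); (4, 329, 120);
      (3, 674, 30); (3, 157, 150); (2, 742, 150); (2, 403, 910);
      (2, 124, 610); (1, 891, 300); (1, 694, 420); (1, 526, 760)]%N.
have hd k : (k < 20)%N -> vcoef a0 k <= decimal (nth (0, 0, 0)%N d k).
  move: k; do 20 (case=> [_|]; [by apply: vcoef_le_decimal; rewrite /decimal /=; lra|]).
  by [].
have T : 2 / (a0 * 20.*2.+1%:R - 1) <= decimal (29, 331, 600)%N.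
  by rewrite -[20.*2.+1]/41%N ler_pdivrMr /decimal /=; lra.
have a1 : 1 < a0 by lra.
apply: le_trans (vfun_le_tail 20 a1) _; rewrite lee_fin.
apply: le_trans (lerD (ler_sum _ (fun (k : 'I_20) _ => hd k (ltn_ord k))) T) _.
rewrite !big_ord_recr big_ord0 /decimal /=; clear.
lra.
Qed.

End numerics.

(** * Polynomial upper bounds for u *)

Section ufun_numerics.
Variable R : realType.
Implicit Types (a x s t c q A : R) (Q : {poly R}).
Local Notation a0 := (1687%:R / 10%:R ^+ 3 + 46%:R / 10%:R ^+ 5 : R).

Let hpolyE := (@hornerD R, @hornerN R, @hornerZ R, @hornerMn R, @hornerXn R, @hornerX R,
  @hornerC R).
Let dpolyE := (@derivD R, @derivN R, @derivZ R, @derivXn R, @derivX R, @derivC R).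

(** ln Q1 - ln Q2 - k t vanishes at 0, and the last hypothesis says that its derivative is
    nonnegative. *)
Lemma expR_le_horner_ratio Q1 Q2 k s : 0 <= s -> Q1.[0] = Q2.[0] ->
  (forall t, 0 <= t <= s -> 0 < Q1.[t]) -> (forall t, 0 <= t <= s -> 0 < Q2.[t]) ->
  (forall t, 0 <= t <= s ->
     k * (Q1.[t] * Q2.[t]) <= Q1^`().[t] * Q2.[t] - Q2^`().[t] * Q1.[t]) ->
  expR (k * s) <= Q1.[s] / Q2.[s].
Proof.
move=> s0 Q0 Q1p Q2p hk.
have ss : 0 <= s <= s by rewrite s0 lexx.
have s00 : 0 <= (0 : R) <= s by apply/andP; split.
pose F := ((@ln R \o horner Q1) - (@ln R \o horner Q2)) - (k \*: (@id R)).
have dF t : 0 <= t <= s ->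
    is_derive t 1 F (Q1.[t]^-1 * Q1^`().[t] - Q2.[t]^-1 * Q2^`().[t] - k * 1).
  move=> t0s.
  have d1 := is_derive1_comp (is_derive1_ln (Q1p t t0s)) (is_derive_poly Q1 t).
  have d2 := is_derive1_comp (is_derive1_ln (Q2p t t0s)) (is_derive_poly Q2 t).
  exact: (is_deriveB (is_deriveB d1 d2) (is_deriveZ k (is_derive_id t (1 : R)))).
have := is_derive_nondecreasing s0 dF.
rewrite -[F 0]/(ln Q1.[0] - ln Q2.[0] - k * 0) -[F s]/(ln Q1.[s] - ln Q2.[s] - k * s).
rewrite Q0 subrr mulr0 subr0 subr_ge0 -ln_div ?posrE ?Q1p ?Q2p// => h.
rewrite -[leRHS]lnK ?posrE ?divr_gt0 ?Q1p ?Q2p// ler_expR; apply: h => t t0s.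
have p1 := Q1p t t0s; have p2 := Q2p t t0s.
rewrite mulr1 subr_ge0.
have -> : Q1.[t]^-1 * Q1^`().[t] - Q2.[t]^-1 * Q2^`().[t] =
    (Q1^`().[t] * Q2.[t] - Q2^`().[t] * Q1.[t]) / (Q1.[t] * Q2.[t]).
  by field; rewrite !gt_eqF.
by rewrite ler_pdivlMr ?mulr_gt0// hk.
Qed.

Definition tanh_poly : {poly R} := 'X - 3^-1 *: 'X^3 + (2 / 15) *: 'X^5.

Lemma tanh_polyE x : tanh_poly.[x] = x - x ^+ 3 / 3 + 2 / 15 * x ^+ 5.
Proof. by rewrite /tanh_poly !hpolyE; ring. Qed.

Lemma deriv_tanh_polyE x : tanh_poly^`().[x] = 1 - x ^+ 2 + 2 / 3 * x ^+ 4.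
Proof. by rewrite /tanh_poly !dpolyE !hpolyE; field. Qed.

(** The claim amounts to exp (2 x) <= (1 + p) / (1 - p) for the Taylor polynomial p of degree 5. In
    differential form this is p' >= 1 - p^2: p is a supersolution of the Riccati equation of
    tanh. *)
Lemma tanh_le_poly x : 0 <= x <= 2^-1 ->
  (1 - expR (- (2 * x))) / (1 + expR (- (2 * x))) <= tanh_poly.[x].
Proof.
move=> /andP[x0 x1].
have qb t : 0 <= t <= x -> 0 <= tanh_poly.[t] < 1.
  move=> /andP[t0 tx]; have t1 := le_trans tx x1; rewrite tanh_polyE.
  have t2 : 0 <= t ^+ 2 <= 4^-1 by rewrite expr2; apply/andP; split; nra.
  have -> : t - t ^+ 3 / 3 + 2 / 15 * t ^+ 5 =
    t * (1 - t ^+ 2 / 3 + 2 / 15 * t ^+ 2 ^+ 2) by ring.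
  by move: (t ^+ 2) t2 => u /andP[u0 u1]; apply/andP; split; nra.
pose Q1 := 1%:P + tanh_poly; pose Q2 := 1%:P - tanh_poly.
have E1 t : Q1.[t] = 1 + tanh_poly.[t] by rewrite /Q1 hornerD hornerC.
have E2 t : Q2.[t] = 1 - tanh_poly.[t] by rewrite /Q2 hornerD hornerN hornerC.
have D1 t : Q1^`().[t] = tanh_poly^`().[t] by rewrite /Q1 derivD derivC add0r.
have D2 t : Q2^`().[t] = - tanh_poly^`().[t].
  by rewrite /Q2 derivD derivN derivC add0r hornerN.
have h : expR (2 * x) <= (1 + tanh_poly.[x]) / (1 - tanh_poly.[x]).
  rewrite -E1 -E2; apply: expR_le_horner_ratio => // [|t t0x|t t0x|t t0x].
  - by rewrite E1 E2 tanh_polyE; ring.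
  - by rewrite E1; have /andP[q0 q1] := qb t t0x; rewrite ltr_pwDl.
  - by rewrite E2; have /andP[q0 q1] := qb t t0x; rewrite subr_gt0.
  - rewrite E1 E2 D1 D2.
    have -> : forall p p' : R, p' * (1 - p) - - p' * (1 + p) = 2 * p' by move=> *; ring.
    have -> : forall p : R, 2 * ((1 + p) * (1 - p)) = 2 * (1 - p ^+ 2) by move=> *; ring.
    rewrite ler_pM2l// deriv_tanh_polyE tanh_polyE -subr_ge0.
    have -> : 1 - t ^+ 2 + 2 / 3 * t ^+ 4 - (1 - (t - t ^+ 3 / 3 + 2 / 15 * t ^+ 5) ^+ 2) =
        (t ^+ 3) ^+ 2 * (17 / 45 - 4 / 45 * t ^+ 2 + 4 / 225 * t ^+ 2 ^+ 2) by field.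
    apply: mulr_ge0; first exact: sqr_ge0.
    (* The quadratic in u = t^2 has its minimum at u = 5 / 2, where it is positive. *)
    have := sqr_ge0 (t ^+ 2 - 5 / 2); set u := t ^+ 2; nra.
have /andP[q0 q1] : 0 <= tanh_poly.[x] < 1 by apply: qb; rewrite x0 lexx.
have e0 := expR_gt0 (2 * x).
rewrite expRN.
have -> : (1 - (expR (2 * x))^-1) / (1 + (expR (2 * x))^-1) =
    (expR (2 * x) - 1) / (expR (2 * x) + 1).
  by field; rewrite !gt_eqF ?addr_gt0// invr_gt0.
rewrite ler_pdivrMr ?addr_gt0//.
by move: h; rewrite ler_pdivlMr ?subr_gt0//; move: (expR _) (tanh_poly.[x]) => e p; nra.
Qed.

(** The right side is the [2/2] Pade approximant of exp (- s); the two sides of the differential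
    inequality differ by exactly t^4. *)
Lemma expRN_le_pade s : 0 <= s ->
  expR (- s) <= (12 - 6 * s + s ^+ 2) / (12 + 6 * s + s ^+ 2).
Proof.
move=> s0.
pose Q1 : {poly R} := 12%:R%:P - 6 *: 'X + 'X^2.
pose Q2 : {poly R} := 12%:R%:P + 6 *: 'X + 'X^2.
have E1 t : Q1.[t] = 12 - 6 * t + t ^+ 2 by rewrite /Q1 !hpolyE.
have E2 t : Q2.[t] = 12 + 6 * t + t ^+ 2 by rewrite /Q2 !hpolyE.
have D1 t : Q1^`().[t] = - 6 + 2 * t by rewrite /Q1 !dpolyE !hpolyE; ring.
have D2 t : Q2^`().[t] = 6 + 2 * t by rewrite /Q2 !dpolyE !hpolyE; ring.
rewrite -mulN1r -E1 -E2; apply: expR_le_horner_ratio => //.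
- by rewrite E1 E2; ring.
- by move=> t _; rewrite E1; have := sqr_ge0 (t - 3); nra.
- by move=> t /andP[t0 _]; rewrite E2; have := sqr_ge0 t; nra.
- move=> t _; rewrite D1 D2 E1 E2 -subr_ge0.
  have -> : (- 6 + 2 * t) * (12 + 6 * t + t ^+ 2) - (6 + 2 * t) * (12 - 6 * t + t ^+ 2)
     - - 1 * ((12 - 6 * t + t ^+ 2) * (12 + 6 * t + t ^+ 2)) = (t ^+ 2) ^+ 2 by ring.
  exact: sqr_ge0.
Qed.

(* The antiderivative of tanh_poly.[A s] (1 + s / 2 + s^2 / 12) / s *)
Definition ubound_poly A : {poly R} :=
  A *: ('X + 4^-1 *: 'X^2 + 36^-1 *: 'X^3
    - (A ^+ 2 / 3) *: (3^-1 *: 'X^3 + 8^-1 *: 'X^4 + 60^-1 *: 'X^5)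
    + (2 / 15 * A ^+ 4) *: (5^-1 *: 'X^5 + 12^-1 *: 'X^6 + 84^-1 *: 'X^7)).

Lemma ubound_polyE A s : (ubound_poly A).[s] =
  A * (s + s ^+ 2 / 4 + s ^+ 3 / 36
    - A ^+ 2 / 3 * (s ^+ 3 / 3 + s ^+ 4 / 8 + s ^+ 5 / 60)
    + 2 / 15 * A ^+ 4 * (s ^+ 5 / 5 + s ^+ 6 / 12 + s ^+ 7 / 84)).
Proof. by rewrite /ubound_poly !hpolyE; ring. Qed.

Lemma deriv_ubound_polyE A s : (ubound_poly A)^`().[s] =
  A * (1 - A ^+ 2 / 3 * s ^+ 2 + 2 / 15 * A ^+ 4 * s ^+ 4) * (1 + s / 2 + s ^+ 2 / 12).
Proof. by rewrite /ubound_poly !dpolyE !hpolyE; field. Qed.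

Lemma ubound_poly_ge0 A s : 0 <= A <= 2^-1 -> 0 <= s <= 1 -> 0 <= (ubound_poly A).[s].
Proof.
move=> /andP[A0 A1] /andP[s0 s1]; rewrite ubound_polyE mulr_ge0//.
have s2 : 0 <= s ^+ 2 <= 1 by rewrite exprn_ge0// exprn_ile1.
have s3 : 0 <= s ^+ 3 <= s by rewrite exprn_ge0//= exprS ler_piMr// (andP s2).2.
have s4 : 0 <= s ^+ 4 <= s by rewrite exprn_ge0//= exprS ler_piMr// exprn_ile1.
have s5 : 0 <= s ^+ 5 <= s by rewrite exprn_ge0//= exprS ler_piMr// exprn_ile1.
have A2 : 0 <= A ^+ 2 <= 4^-1 by rewrite expr2; apply/andP; split; nra.
have r : 0 <= 2 / 15 * A ^+ 4 * (s ^+ 5 / 5 + s ^+ 6 / 12 + s ^+ 7 / 84).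
  by rewrite mulr_ge0 ?mulr_ge0 ?addr_ge0 ?divr_ge0 ?exprn_ge0.
rewrite addr_ge0// subr_ge0.
move: s2 s3 s4 s5 A2; move: (s ^+ 2) (s ^+ 3) (s ^+ 4) (s ^+ 5) (A ^+ 2) => x2 x3 x4 x5 B.
move=> /andP[? ?] /andP[? ?] /andP[? ?] /andP[? ?] /andP[? ?].
apply: (@le_trans _ _ (12^-1 * s)); last lra.
apply: (@le_trans _ _ (12^-1 * (x3 / 3 + x4 / 8 + x5 / 60))); last lra.
by rewrite ler_wpM2r; lra.
Qed.

(** A crude bound, meant for A = 1 / (2 a), where it reads 1 / a. *)
Lemma ubound_poly_le A s : 0 <= A <= 2^-1 -> 0 <= s <= 1 -> (ubound_poly A).[s] <= 2 * A.
Proof.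
move=> /andP[A0 A1] /andP[s0 s1]; rewrite ubound_polyE mulrC ler_wpM2r//.
have sn n : 0 <= s ^+ n <= 1 by rewrite exprn_ge0// exprn_ile1.
have A4 : 0 <= A ^+ 4 <= 1 by rewrite exprn_ge0// exprn_ile1//; lra.
have A2 : 0 <= A ^+ 2 / 3 * (s ^+ 3 / 3 + s ^+ 4 / 8 + s ^+ 5 / 60).
  by rewrite mulr_ge0 ?addr_ge0 ?divr_ge0 ?exprn_ge0.
move: (A ^+ 2 / 3 * _) A2 => Z Z0.
have := sn 2%N; have := sn 3%N; have := sn 5%N; have := sn 6%N; have := sn 7%N.
move: A4; move: (A ^+ 4) (s ^+ 2) (s ^+ 3) (s ^+ 5) (s ^+ 6) (s ^+ 7).
move=> B x2 x3 x5 x6 x7 /andP[? ?] /andP[? ?] /andP[? ?] /andP[? ?] /andP[? ?] /andP[? ?].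
have : B * (x5 / 5 + x6 / 12 + x7 / 84) <= 1 * (x5 / 5 + x6 / 12 + x7 / 84).
  by rewrite ler_wpM2r//; lra.
by lra.
Qed.

(** The Pade bound gives 1 / (1 - exp (- s)) <= (1 + s / 2 + s^2 / 12) / s. The denominator s
    cancels against the Taylor polynomial of tanh at s / (2 a), so the integrand is bounded by a
    polynomial. *)
Lemma ufun_le_ubound a q : 1 <= a -> 0 < q <= 1 ->
  (ubound_poly (2 * a)^-1).[ln (1 + q)] <= - ln q ->
  (ufun a%:E <= (- ln q)%:E)%E.
Proof.
move=> a1 /[dup] q01 /andP[q0 q1] hc.
have a0 : 0 < a by rewrite (lt_le_trans ltr01).
pose A := (2 * a)^-1.
have A0 : 0 < A by rewrite invr_gt0 mulr_gt0.
have A1 : A <= 2^-1 by rewrite lef_pV2 ?posrE ?mulr_gt0//; lra.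
have s01 : ln (1 + q) <= 1 by rewrite (le_trans (le_ln1Dx _))//; lra.
apply: ufun_le_poly hc => //.
  move=> s /andP[s0 ss]; have s1 := le_trans ss s01.
  have xE : s / a = 2 * (A * s) by rewrite /A; field; rewrite gt_eqF.
  have x01 : 0 <= A * s <= 2^-1.
    rewrite (mulr_ge0 (ltW A0) (ltW s0))/=; apply: le_trans A1.
    by rewrite -[leRHS]mulr1 ler_wpM2l// ltW.
  have := tanh_le_poly x01; rewrite -xE => ht.
  have hp := expRN_le_pade (ltW s0).
  have d0 : 0 < 12 + 6 * s + s ^+ 2 by have := sqr_ge0 s; nra.
  have e1 : expR (- s) < 1 by rewrite expR_lt1; lra.
  have hp' : (1 - expR (- s))^-1 <= (12 + 6 * s + s ^+ 2) / (12 * s).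
    rewrite -[leRHS]invrK lef_pV2 ?posrE ?subr_gt0 ?invr_gt0 ?divr_gt0 ?mulr_gt0//.
    rewrite invf_div lerBrDr -lerBrDl; apply: le_trans hp _.
    by rewrite le_eqVlt; apply/orP; left; apply/eqP; field; rewrite gt_eqF.
  rewrite invfM mulrA.
  have t0 : 0 <= (1 - expR (- (s / a))) / (1 + expR (- (s / a))).
    apply: divr_ge0; last by rewrite addr_ge0 ?expR_ge0.
    by rewrite subr_ge0 expR_le1 oppr_le0 divr_ge0 ?(ltW s0) ?(ltW a0).
  apply: le_trans (ler_pM t0 _ ht hp') _; first by rewrite invr_ge0 subr_ge0 ltW.
  rewrite tanh_polyE deriv_ubound_polyE -/A le_eqVlt; apply/orP; left; apply/eqP.
  by field; rewrite gt_eqF.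
move=> s /andP[s0 ss]; apply: ubound_poly_ge0; first by rewrite ltW.
by rewrite s0 (le_trans ss).
Qed.

Lemma ufun_le_inv a : 1 <= a -> (ufun a%:E <= (a^-1)%:E)%E.
Proof.
move=> a1; have a0 : 0 < a by rewrite (lt_le_trans ltr01).
have -> : a^-1 = - ln (expR (- a^-1)) by rewrite expRK opprK.
have q1 : expR (- a^-1) <= 1 by rewrite expR_le1 oppr_le0 invr_ge0 ltW.
have q0 := expR_gt0 (- a^-1).
apply: ufun_le_ubound => //; first by rewrite q0.
rewrite expRK opprK; apply: le_trans (ubound_poly_le _ _) _.
- by rewrite invr_ge0 mulr_ge0 ?(ltW a0)//= lef_pV2 ?posrE ?mulr_gt0//; lra.
- rewrite ln_ge0 ?lerDl ?(ltW q0)//=; apply: le_trans q1; apply: le_ln1Dx.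
  by lra.
- by rewrite invfM mulrA divff ?mul1r ?pnatr_eq0.
Qed.

End ufun_numerics.

(** * The comparison at 1.68746 *)

Section kfun_numerics.
Variable R : realType.
Local Notation a0 := (1687%:R / 10%:R ^+ 3 + 46%:R / 10%:R ^+ 5 : R).

(* The maximum u(a0) is - ln q for q = 0.815445..., and 2 u(a0) + v(a0) is below
   a0 ln 4 by less than 3 / 10^5; the fraction 243 / 298 is close enough to q. *)
Local Notation q0 := (243 / 298 : R).

Lemma ln_q0_bounds :
  204%:R / 10%:R ^+ 3 + 31%:R / 10%:R ^+ 6 <= - ln q0
    <= 204%:R / 10%:R ^+ 3 + 325%:R / 10%:R ^+ 7.
Proof.
have h : 0 <= (55 / 298 : R) < 1 by lra.
have e : 1 - 55 / 298 = q0 by lra.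
have e' : (q0)^-1 = 298 / 243 by rewrite invf_div.
have := logpoly_le 7 h; have := le_logpoly 7 h.
rewrite !horner_logpoly !big_ord_recr big_ord0/= invfM e e'.
lra.
Qed.

Lemma ln_1Dq0_le : ln (1 + q0) <= 596%:R / 10%:R ^+ 3 + 328%:R / 10%:R ^+ 6.
Proof.
have h : 0 <= (55 / 596 : R) < 1 by lra.
have -> : 1 + q0 = 2 * (1 - 55 / 596) by lra.
rewrite lnM ?posrE; [|lra|lra].
have := logpoly_le 5 h; have /andP[_] := ln2_bounds R.
rewrite !horner_logpoly !big_ord_recr big_ord0/=.
lra.
Qed.

Lemma ufun_bound :
  (ufun a0%:E <= (204%:R / 10%:R ^+ 3 + 325%:R / 10%:R ^+ 7)%:E)%E.
Proof.
have /andP[c1 c2] := ln_q0_bounds.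
apply: (@le_trans _ _ (- ln q0)%:E); last by rewrite lee_fin.
apply: ufun_le_ubound; [lra|lra|apply: le_trans c1].
have s0 : 0 <= ln (1 + q0) by apply: ln_ge0; lra.
have s1 := ln_1Dq0_le.
pose A : R := (2 * a0)^-1; pose S : R := 596%:R / 10%:R ^+ 3 + 328%:R / 10%:R ^+ 6.
pose Al : R := 296%:R / 10%:R ^+ 3 + 303%:R / 10%:R ^+ 6.
pose Ah : R := 296%:R / 10%:R ^+ 3 + 304%:R / 10%:R ^+ 6.
have A1 : Al <= A by rewrite -[leRHS]mul1r ler_pdivlMr /Al; lra.
have A2 : A <= Ah by rewrite -[leLHS]mul1r ler_pdivrMr /Ah; lra.
have Al0 : 0 <= Al by rewrite /Al; lra.
have A0 : 0 <= A := le_trans Al0 A1.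
have A3 : A <= 2^-1 by apply: le_trans A2 _; rewrite /Ah; lra.
rewrite -/A; apply: (@le_trans _ _ (ubound_poly A).[S]).
  apply: (is_derive_nondecreasing s1 (fun t _ => is_derive_poly (ubound_poly A) t)).
  move=> t /andP[t0 tS].
  have t1 : t <= 1 by apply: le_trans tS _; rewrite /S; lra.
  have t00 : 0 <= t := le_trans s0 t0.
  have t2 : 0 <= t ^+ 2 <= 1 by rewrite exprn_ge0// exprn_ile1.
  rewrite deriv_ubound_polyE; apply: mulr_ge0; last by move: t2; lra.
  apply: mulr_ge0 => //; rewrite addr_ge0//; last first.
    by rewrite mulr_ge0 ?exprn_ge0// mulr_ge0 ?exprn_ge0// divr_ge0.
  have /andP[B0 B1] : 0 <= A ^+ 2 <= 1 by rewrite exprn_ge0// exprn_ile1//; lra.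
  by move: t2 B0 B1; move: (t ^+ 2) (A ^+ 2) => x y /andP[? ?] ? ?; nra.
have B1 : Al ^+ 2 <= A ^+ 2 by rewrite lerXn2r ?nnegrE.
have B2 : A ^+ 4 <= Ah ^+ 4 by rewrite lerXn2r ?nnegrE// (le_trans A0).
(* [Al] and [Ah] enclose A to six decimals; the lower value enters only the negative term, so [W] is
   an upper bound. *)
pose W : R := S + S ^+ 2 / 4 + S ^+ 3 / 36
    - Al ^+ 2 / 3 * (S ^+ 3 / 3 + S ^+ 4 / 8 + S ^+ 5 / 60)
    + 2 / 15 * Ah ^+ 4 * (S ^+ 5 / 5 + S ^+ 6 / 12 + S ^+ 7 / 84).
have W0 : 0 <= W by rewrite /W /S /Al /Ah; lra.
apply: (@le_trans _ _ (Ah * W)); last by rewrite /W /S /Al /Ah; lra.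
rewrite ubound_polyE; apply: (@le_trans _ _ (A * W)); last by rewrite ler_wpM2r.
have S0 n : 0 <= S ^+ n by rewrite exprn_ge0// /S; lra.
rewrite ler_wpM2l// /W lerD//.
  by rewrite lerD2l lerN2 ler_wpM2r ?addr_ge0 ?divr_ge0// ler_wpM2r// invr_ge0.
by rewrite ler_wpM2r ?addr_ge0 ?divr_ge0// ler_wpM2l.
Qed.

Lemma kfun_lt1 a : a0 <= a -> (kfun a%:E < 1)%E.
Proof.
move=> aa; have a0_1 : 1 < a0 by lra.
have a01 : 1 < a := lt_le_trans a0_1 aa.
have [cu [cv [ub vb uv]]] : exists cu cv : R,
    [/\ (ufun a%:E <= cu%:E)%E, (vfun a%:E <= cv%:E)%E & 2 * cu + cv < a0 * ln 4].
  (* 2 * 0.2040325 + 1.93125 = 2.339315, against 2.339316... for a0 ln 4. This margin of about 10^-6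
     dictates the precision of all preceding constants. *)
  exists (204%:R / 10%:R ^+ 3 + 325%:R / 10%:R ^+ 7).
  exists (193%:R / 10%:R ^+ 2 + 1250%:R / 10%:R ^+ 6); split.
  - by apply: le_trans (ufun_nincr _ aa) ufun_bound; lra.
  - exact: le_trans (vfun_nincr a0_1 aa) (vfun_bound R).
  - have -> : ln 4 = 2 * ln 2 :> R.
      by rewrite (_ : 4 = 2 ^+ 2 :> R) ?lnXn ?mulr_natl//; lra.
    have /andP[h _] := ln2_bounds R; lra.
have a4 : 0 <= ln 4 :> R by rewrite ln_ge0// ler1n.
have au : a0 * ln 4 <= a * ln 4 by rewrite ler_wpM2r.
have uva := lt_le_trans uv au.
apply: (@le_lt_trans _ _ ((4 `^ (- a))%:E * expeR (2 * cu + cv)%R%:E)%E).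
  rewrite /kfun; apply: lee_wpmul2l; first by rewrite lee_fin powR_ge0.
  rewrite lee_expeR [leRHS]EFinD EFinM; apply: leeD => //.
  by apply: lee_wpmul2l => //; rewrite lee_fin.
rewrite /= -EFinM lte_fin /powR gt_eqF// -expRD expR_lt1.
by rewrite mulNr addrC subr_lt0.
Qed.

End kfun_numerics.

(** * Growth of U and V *)

Section moments.
Variables (R : realType) (b : nat -> R) (mu : probability (measurableTypeR R) R).
Hypothesis b_gt0 : forall n, 0 < b n.
Hypothesis mu_orth : is_orthonormal_for b mu.

Local Notation P := (orthopoly b).
Local Notation B n := (\prod_(i < n) b i).
Local Notation A := (xpow_coef b).
Local Notation I p := (\int[mu]_x (p : {poly R}).[x])%R.

Lemma integrable_horner (p : {poly R}) : mu.-integrable setT (fun x => (p.[x])%:E).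
Proof.
have -> : (fun x => (p.[x])%:E) = (fun x : R => (\sum_(i < size p) p`_i * x ^+ i)%:E).
  by apply/funext => x; rewrite horner_coef.
elim: (size p) => [|n ih].
  under eq_fun do rewrite big_ord0; exact: integrable0.
have -> : (fun x : R => (\sum_(i < n.+1) p`_i * x ^+ i)%:E) =
    ((fun x : R => (\sum_(i < n) p`_i * x ^+ i)%:E) \+ (fun x : R => (p`_n)%:E * (x ^+ n)%:E))%E.
  by apply/funext => x; rewrite big_ord_recr/= EFinD EFinM.
apply: integrableD => //.
by apply: integrableZl => //; exact: mu_orth.1.
Qed.

Lemma Rintegral_horner_sum m (c : nat -> R) (p : nat -> {poly R}) :
  I (\sum_(k < m) c k *: p k) = \sum_(k < m) c k * I (p k).
Proof.
elim: m => [|m ih].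
  by rewrite !big_ord0; under eq_Rintegral do rewrite horner0; rewrite Rintegral_cst// mul0r.
rewrite big_ord_recr [in RHS]big_ord_recr/= -ih.
set q := \sum_(k < m) _; transitivity (\int[mu]_x (q.[x] + c m * (p m).[x]))%R.
  by apply: eq_Rintegral => x _; rewrite hornerD hornerZ.
rewrite RintegralD//; first last.
- have -> : EFin \o (fun x => c m * (p m).[x]) = (fun x => ((c m *: p m).[x])%:E).
    by apply/funext => x; rewrite hornerZ.
  exact: integrable_horner.
- exact: integrable_horner.
by rewrite RintegralZl//; exact: integrable_horner.
Qed.

Lemma Rintegral_orthopolyM m n : I (P m * P n) = (m == n)%:R.
Proof.
rewrite /Rintegral; under eq_integral do rewrite hornerM.
by rewrite mu_orth.2.
Qed.

(** Parseval's identity for the expansions of x^n and x^n' in the orthonormal polynomials. *)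
Lemma moment_add n n' m : (n < m)%N -> (n' < m)%N ->
  moment mu (n + n') = \sum_(k < m) A n k * A n' k.
Proof.
move=> nm n'm.
have -> : moment mu (n + n') = I ('X^n * 'X^n').
  rewrite /moment; congr fine; apply: eq_integral => x _.
  by rewrite -exprD hornerXn.
rewrite (xpow_coefE b_gt0 nm) mulr_suml.
under eq_bigr do rewrite -scalerAl.
rewrite (Rintegral_horner_sum m (A n) (fun k => P k * 'X^n')).
apply: eq_bigr => k _; congr (_ * _).
rewrite (xpow_coefE b_gt0 n'm) mulr_sumr.
under eq_bigr do rewrite -scalerAr.
rewrite (Rintegral_horner_sum m (A n') (fun l => P k * P l)).
under eq_bigr do rewrite Rintegral_orthopolyM.
rewrite (bigD1 k)//= eqxx mulr1 big1 ?addr0// => l /negbTE lk.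
by rewrite eq_sym -val_eqE/= in lk; rewrite lk mulr0.
Qed.

(** In the Parseval sum for p and p + 1, parity kills one of the two factors of each term. *)
Lemma moment_odd p : moment mu p.*2.+1 = 0.
Proof.
rewrite -addnn -addnS (@moment_add p p.+1 p.+2)//.
rewrite big1// => k _; have [pk|npk] := boolP (odd (p + k)).
  by rewrite xpow_coef_odd// mul0r.
by rewrite [X in _ * X]xpow_coef_odd ?mulr0// addSn/=.
Qed.

Lemma prodb2E n : \prod_(i < n) b i ^+ 2 = (B n) ^+ 2.
Proof. by rewrite prodrXl. Qed.

Lemma Useq_eq n : Useq b mu n = \sum_(k < n.+1) (A n k / B n) ^+ 2.
Proof.
rewrite /Useq mul2n -addnn (@moment_add n n n.+1)// prodb2E mulr_suml.
by apply: eq_bigr => k _; rewrite expr_div_n expr2.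
Qed.

Lemma Useq_ge0 n : 0 <= Useq b mu n.
Proof. by rewrite Useq_eq sumr_ge0// => k _; rewrite sqr_ge0. Qed.

Lemma momentE n : moment mu n.*2 = (B n) ^+ 2 * Useq b mu n.
Proof.
rewrite /Useq mul2n prodb2E mulrC divfK// expf_neq0// gt_eqF//.
exact: prodb_gt0.
Qed.

End moments.

(** * From the liminf to power bounds on ratios *)

Section ratios.
Variables (R : realType) (b : nat -> R).
Hypothesis b_gt0 : forall n, 0 < b n.

Definition ratio_pow (a : R) (n2 : nat) : Prop :=
  forall k n, (k <= n)%N -> (n2 <= n)%N -> b k / b n <= (k.+1%:R / n.+1%:R) `^ a.

Lemma lt_limn_einf (u : nat -> \bar R) (x : \bar R) : (x < limn_einf u)%E ->
  exists n, forall k, (n <= k)%N -> (x < u k)%E.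
Proof.
move=> xu; apply: contrapT => h; move: xu; apply/negP; rewrite -leNgt limn_einf_lim.
apply: lime_le; first exact: is_cvg_einfs.
near=> n; rewrite leNgt; apply/negP => xn; apply: h; exists n => k nk.
by apply: lt_le_trans xn _; apply: ereal_inf_lbound; exists k.
Unshelve. all: by end_near. Qed.

Lemma EFin_lt_between (x : R) (y : \bar R) : (x%:E < y)%E ->
  exists2 z, x < z & (z%:E < y)%E.
Proof.
case: y => [y| |]//.
  by rewrite lte_fin => xy; exists ((x + y) / 2); rewrite ?lte_fin; lra.
by move=> _; exists (x + 1); rewrite ?ltry//; lra.
Qed.

Lemma expRN_div_le (a : R) n : 0 <= a -> (0 < n)%N ->
  expR (- (a / n%:R)) <= (n%:R / n.+1%:R) `^ a.
Proof.
move=> a0 n0; have np : 0 < n%:R :> R by rewrite ltr0n.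
have n1p : 0 < n.+1%:R :> R by rewrite ltr0n.
have q0 : 0 < n%:R / n.+1%:R :> R by rewrite divr_gt0.
rewrite /powR gt_eqF// ler_expR -mulrN ler_wpM2l//.
rewrite -invf_div lnV ?posrE ?divr_gt0// lerN2.
rewrite -natr1 mulrDl divff ?gt_eqF// mul1r.
by apply: le_ln1Dx; rewrite (lt_trans (ltrN10 _))// invr_gt0.
Qed.

(** Multiplying the one-step bounds gives an exponent a2 > a for n1 <= k <= n. A smaller k is
    compared with n1 at the price of a constant [C], which (n + 1)^(a2 - a) absorbs once n >= n2. *)
Lemma ratio_pow_ex (f : nat -> R) (n0 : nat) (a : R) :
  (0 < n0)%N ->
  (forall n, (n0 <= n)%N -> b n.-1 / b n <= expR (- f n)) ->
  0 <= a -> (a%:E < limn_einf (fun n => (n%:R * f n)%:E))%E ->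
  exists n2, ratio_pow a n2.
Proof.
move=> n0_gt0 bf a_ge0 af.
have [a2 aa2 a2f] := EFin_lt_between af.
have [m0 hm0] := lt_limn_einf a2f.
pose n1 := maxn m0 n0.
have a20 : 0 <= a2 by rewrite (le_trans a_ge0)// ltW.
have step n : (n1 <= n)%N -> b n.-1 / b n <= (n%:R / n.+1%:R) `^ a2.
  rewrite geq_max => /andP[m0n n0n].
  have npos : (0 < n)%N by exact: leq_trans n0n.
  apply: le_trans (expRN_div_le a20 npos).
  apply: le_trans (bf n n0n) _; rewrite ler_expR lerN2 ler_pdivrMr ?ltr0n//.
  by have := hm0 n m0n; rewrite lte_fin mulrC => /ltW.
have chain k n : (n1 <= k)%N -> (k <= n)%N -> b k / b n <= (k.+1%:R / n.+1%:R) `^ a2.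
  move=> n1k; elim: n => [|n ih].
    by rewrite leqn0 => /eqP ->; rewrite !divff ?powR1 ?gt_eqF.
  rewrite leq_eqVlt => /predU1P[->|]; first by rewrite !divff ?powR1 ?gt_eqF.
  rewrite ltnS => kn.
  have -> : b k / b n.+1 = (b k / b n) * (b n / b n.+1) by field; rewrite !gt_eqF.
  have -> : k.+1%:R / n.+2%:R = (k.+1%:R / n.+1%:R) * (n.+1%:R / n.+2%:R) :> R.
    by rewrite mulrA divfK// pnatr_eq0.
  rewrite powRM ?divr_ge0//; apply: ler_pM; rewrite ?divr_ge0 ?(ltW (b_gt0 _))//.
    exact: ih.
  by apply: (step n.+1); rewrite (leq_trans n1k)// ltnW.
pose K0 := \sum_(k < n1) b k / b n1.
have K0k k : (k < n1)%N -> b k / b n1 <= K0.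
  move=> kn; rewrite /K0 (bigD1 (Ordinal kn))//= lerDl sumr_ge0// => i _.
  by rewrite divr_ge0// ltW.
have K00 : 0 <= K0 by rewrite sumr_ge0// => i _; rewrite divr_ge0// ltW.
pose C := K0 * n1.+1%:R `^ a2.
have C0 : 0 <= C by rewrite mulr_ge0// powR_ge0.
pose d := a2 - a; have d0 : 0 < d by rewrite subr_gt0.
pose n2 := maxn n1 (Num.truncn (C `^ d^-1)).
exists n2 => k n kn; rewrite geq_max => /andP[n1n tn].
have pn : 0 < n.+1%:R :> R by rewrite ltr0n.
have [n1k|kn1] := leqP n1 k.
  apply: le_trans (chain k n n1k kn) _.
  have q0 : 0 < k.+1%:R / n.+1%:R :> R by rewrite divr_gt0 ?ltr0n.
  apply: ger_powR; last exact: ltW.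
  by rewrite q0 ler_pdivrMr// mul1r ler_nat ltnS.
have Cn : C <= n.+1%:R `^ d.
  have -> : C = (C `^ d^-1) `^ d by rewrite -powRrM mulVf ?gt_eqF// powRr1.
  apply: ge0_ler_powR; rewrite ?nnegrE ?powR_ge0 ?ler0n ?(ltW d0)//.
  by apply: le_trans (ltW (truncnS_gt _)) _; rewrite ler_nat ltnS.
have -> : b k / b n = (b k / b n1) * (b n1 / b n) by field; rewrite !gt_eqF.
apply: (@le_trans _ _ (K0 * (n1.+1%:R / n.+1%:R) `^ a2)).
  by apply: ler_pM; rewrite ?divr_ge0 ?(ltW (b_gt0 _)) ?K0k ?chain.
apply: (@le_trans _ _ (n.+1%:R^-1 `^ a)).
  rewrite powRM ?invr_ge0// mulrA -/C.
  rewrite -[n.+1%:R^-1]powR_inv1 ?ler0n// -!powRrM !mulN1r.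
  have -> : a2 = d + a by rewrite /d subrK.
  rewrite opprD powRD; last by apply/implyP => _; rewrite gt_eqF.
  rewrite mulrA ler_piMl ?powR_ge0// powRN ler_pdivrMr ?powR_gt0// mul1r.
  exact: Cn.
apply: ge0_ler_powR => //; rewrite ?nnegrE ?invr_ge0 ?divr_ge0//.
by rewrite ler_peMl ?invr_ge0// ler1n.
Qed.

End ratios.

(** * Exponential growth of U *)

Section U_growth.
Variables (R : realType) (b : nat -> R) (mu : probability (measurableTypeR R) R).
Hypothesis b_gt0 : forall n, 0 < b n.
Hypothesis mu_orth : is_orthonormal_for b mu.

Local Notation B n := (\prod_(i < n) b i).

(** For 0 < z < 1 the condition z (t + 1) <= t means t >= z / (1 - z); the exponential of [phip] is
    the maximum of this with 1. *)
Lemma expR_phip_ge (a y : R) : 0 < a -> 0 < y < 1 ->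
  y `^ a * (expR (phip a y) + 1) <= expR (phip a y).
Proof.
move=> a0 y01; have /andP[z0 z1] := powR_itv01 a0 y01.
have : y `^ a / (1 - y `^ a) <= expR (phip a y).
  rewrite -[leLHS]lnK ?posrE ?divr_gt0 ?subr_gt0// phiE// ler_expR.
  by rewrite /phip le_max lexx orbT.
by rewrite ler_pdivrMr ?subr_gt0//; move: (y `^ a) (expR _) => z t; lra.
Qed.

(** The factor missed by the Riemann sum grows only linearly, which does not affect exponential
    rates. Here 1 - y_1 = 1 / (M + 1), and 1 - y is compared with 1 - y^a through y^a <= y if a >=
    1, and through Bernoulli with exponent 1 / a otherwise. *)
Lemma expR_phip_ygrid1 (a : R) M : 0 < a -> (0 < M)%N ->
  expR (phip a (ygrid R M 1)) <= (1 + a^-1) * M.+1%:R.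
Proof.
move=> a0 M0; set y := ygrid R M 1.
have y01 : 0 < y < 1 by exact: ygrid_itv.
have /andP[y0 y1] := y01; have /andP[z0 z1] := powR_itv01 a0 y01.
have Mp : 0 < M.+1%:R :> R by rewrite ltr0n.
have ai : 0 < a^-1 by rewrite invr_gt0.
have yE : 1 - y = M.+1%:R^-1.
  rewrite /y /ygrid addn1 subn1 prednK//.
  have -> : M%:R = M.+1%:R - 1 :> R by rewrite -natr1 addrK.
  by rewrite mulrBl divff ?gt_eqF// mul1r opprB addrC subrK.
have M1 : 1 <= (1 + a^-1) * M.+1%:R.
  by rewrite -[leLHS]mulr1 ler_pM ?ler1n// lerDl ltW.
rewrite /phip; case: (leP 0 (phi a y)) => [p0|/ltW p0]; last by rewrite expR0.
rewrite -phiE// lnK ?posrE ?divr_gt0 ?subr_gt0//.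
have : 1 - y <= (1 + a^-1) * (1 - y `^ a).
  have [a1|/ltW a1] := leP 1 a.
    have h : y `^ a <= y by apply: ge1r_powR => //; rewrite y0 ltW.
    have : 0 <= a^-1 * (1 - y `^ a) by apply: mulr_ge0; [exact: ltW|rewrite subr_ge0 ltW].
    by rewrite mulrDl mul1r; lra.
  have a1' : 1 <= a^-1 by rewrite invf_ge1.
  have := bernoulli_powR a1' (ltW z0).
  rewrite -powRrM divff ?gt_eqF// powRr1 ?(ltW y0)// => h; apply: le_trans h _.
  by rewrite ler_wpM2r ?subr_ge0 ?(ltW z1)// lerDr.
rewrite yE => h; rewrite ler_pdivrMr ?subr_gt0//; apply: le_trans (ltW z1) _.
rewrite mulrAC -[leLHS](mulVf (lt0r_neq0 Mp)).
by rewrite ler_wpM2r// ltW.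
Qed.

Lemma ratio_ygrid_le (a : R) n2 M m j k : 0 < a -> ratio_pow b a n2 ->
  (0 < j)%N -> (j <= m)%N -> (m <= M)%N -> (n2 < m + j)%N -> (k <= m - j)%N ->
  b k / b (m + j).-1 <= (ygrid R M j) `^ a.
Proof.
move=> a0 rp j0 jm mM nmj kmj.
have mj0 : (0 < m + j)%N by rewrite addn_gt0 j0 orbT.
apply: le_trans (rp k (m + j).-1 _ _) _; [lia|lia|].
rewrite prednK//; apply: ge0_ler_powR; rewrite ?nnegrE ?divr_ge0 ?ler0n ?(ltW a0)//.
rewrite /ygrid ler_pdivrMr ?ltr0n// mulrAC ler_pdivlMr ?ltr0n; last by lia.
by rewrite -!natrM ler_nat; nia.
Qed.

Lemma ufun_ge0 (a : R) : 0 < a -> (0 <= ufun a%:E)%E.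
Proof.
move=> a0; apply: le_trans (@Up_le_ufun R a 1 a0 _); last by rewrite ltr01 lexx.
by rewrite mule_ge0 ?Up_ge0// lee_fin.
Qed.

(** U_N is a sum of N + 1 squares, each of a number at most a multiple of (N + 1) exp (u N); this
    gives the cube. *)
Lemma Useq_growth (a u : R) n2 : 0 < a -> ratio_pow b a n2 -> (ufun a%:E <= u%:E)%E ->
  exists2 K, 0 <= K & forall N, Useq b mu N <= K * N.+1%:R ^+ 3 * expR (2 * u * N%:R).
Proof.
move=> a0 rp ua.
have u0 : 0 <= u by have := le_trans (ufun_ge0 a0) ua; rewrite lee_fin.
have [K K1 hK] := xpow_coef_le b_gt0 n2.
have K0 : 0 <= K by rewrite (le_trans ler01).
pose D := K * (1 + a^-1).
have D0 : 0 <= D by rewrite mulr_ge0// addr_ge0// invr_ge0 ltW.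
exists (D ^+ 2) => [|N]; first exact: sqr_ge0.
have key k : (k <= N)%N -> xpow_coef b N k / B N <= D * N.+1%:R * expR (u * N%:R).
  move=> kN; have B0 := prodb_gt0 b_gt0 N.
  have rhs0 : 0 <= D * N.+1%:R * expR (u * N%:R) by rewrite mulr_ge0 ?expR_ge0// mulr_ge0.
  have [Nk|Nk] := boolP (odd (N + k)); first by rewrite xpow_coef_odd// mul0r.
  pose j := (N - k)./2; pose M := (N - j)%N.
  have jE : (N = k + j.*2)%N.
    by rewrite /j even_halfK ?subnKC// oddB// -oddD.
  have jM : (j <= M)%N by rewrite /M; clear -jE; lia.
  have MjN : (M + j = N)%N by rewrite /M; clear -jE; lia.
  have Mjk : (M - j = k)%N by rewrite /M; clear -jE; lia.
  pose y i := ygrid R M i.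
  pose ok i := (0 < i)%N && (i <= M)%N.
  (* The bounds are required for all i, but y_0 would exceed 1 and for i > M the subtraction is
     truncated. The values z = 0 and t = 1 are harmless there. *)
  pose z i := if ok i then y i `^ a else 0.
  pose t i := if ok i then expR (phip a (y i)) else 1.
  have t1 i : 1 <= t i.
    rewrite /t; case: ifP => // _; rewrite -expR0 ler_expR; exact: phip_ge0.
  have zt i : z i * (t i + 1) <= t i.
    rewrite /z /t; case: ifP => [/andP[i0 iM]|_]; last by rewrite mul0r.
    by apply: expR_phip_ge => //; exact: ygrid_itv.
  have := hK M z t t1 zt _ M j (leqnn M) jM; rewrite MjN Mjk => h.
  rewrite ler_pdivrMr//; apply: le_trans (h _) _.
    move=> m i l i0 im mM nmi lmi; rewrite /z /ok i0 (leq_trans im mM)/=.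
    exact: ratio_ygrid_le rp i0 im mM nmi lmi.
  rewrite mulrAC ler_wpM2r ?(ltW B0)// /D -!mulrA ler_wpM2l//.
  have tE : \prod_(i < j) t i.+1 = expR (\sum_(i < j) phip a (y i.+1)).
    rewrite expR_sum; apply: eq_bigr => i _.
    by rewrite /t /ok ifT//=; apply: leq_trans jM.
  rewrite tE; have [j0|j0] := posnP j.
    rewrite j0 big_ord0 expR0 -[leLHS]mulr1 ler_pM ?lerDl ?invr_ge0 ?(ltW a0)//.
    by rewrite -[leLHS]mulr1 ler_pM ?ler1n// -expR0 ler_expR mulr_ge0.
  have -> : \sum_(i < j) phip a (y i.+1) = phip a (y 1) + \sum_(i < j.-1) phip a (y i.+2).
    by rewrite -[in LHS](prednK j0) big_ord_recl.
  rewrite expRD mulrA; apply: ler_pM; rewrite ?expR_ge0//.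
    apply: le_trans (expR_phip_ygrid1 a0 _) _; first exact: leq_trans jM.
    by rewrite ler_wpM2l ?ler_nat ?addr_ge0 ?invr_ge0 ?(ltW a0)// ltnS leq_subr.
  rewrite ler_expR mulrC -[in leRHS]MjN.
  exact: (sum_phip_le a0 ua j0 jM).
rewrite (Useq_eq b_gt0 mu_orth).
apply: (@le_trans _ _ (\sum_(k < N.+1) (D * N.+1%:R * expR (u * N%:R)) ^+ 2)).
  apply: ler_sum => k _; rewrite lerXn2r ?nnegrE ?key ?(leq_ord k)//.
    by rewrite divr_ge0 ?xpow_coef_ge0// ltW// prodb_gt0.
  by rewrite mulr_ge0 ?expR_ge0// mulr_ge0.
rewrite sumr_const card_ord -mulr_natr !exprMn.
rewrite (_ : expR (2 * u * N%:R) = expR (u * N%:R) ^+ 2); last first.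
  by rewrite -expRM_natl mulrA.
by rewrite le_eqVlt; apply/orP; left; apply/eqP; ring.
Qed.

End U_growth.

(** * Exponential growth of V *)

Section V_growth.
Variables (R : realType) (b : nat -> R).
Hypothesis b_gt0 : forall n, 0 < b n.

Local Notation P := (orthopoly b).
Local Notation B n := (\prod_(i < n) b i).


Lemma sum_sq_even (F : nat -> R) n m :
  (forall i, 0 <= F i) -> (forall i, odd (n + i) -> F i = 0) ->
  \sum_(n <= i < m) F i <= \sum_(j < m) F (n + j.*2)%N.
Proof.
move=> F0 Fodd.
have E l : \sum_(n <= i < n + l.*2) F i = \sum_(j < l) F (n + j.*2)%N.
  elim: l => [|l ih]; first by rewrite addn0 big_geq// big_ord0.
  rewrite doubleS !addnS big_nat_recr ?leqW ?leq_addr//= big_nat_recr ?leq_addr//=.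
  rewrite ih big_ord_recr/= [F (n + l.*2).+1]Fodd ?addr0//.
  by rewrite addnS oddS addnA addnn oddD !odd_double.
rewrite -E; have [nm|mn] := leqP n m; last first.
  by rewrite big_geq ?(ltnW mn)// sumr_ge0.
rewrite [leRHS](big_cat_nat (n := m))//= ?lerDl ?sumr_ge0//.
by rewrite -addnn; lia.
Qed.

(** The left side is V_n^2. Allowing n <= N, and not only n = N, gives the finiteness of c_0 as
    well, from N = 1. *)
Lemma ccoef_growth (a v : R) n2 : 1 < a -> ratio_pow b a n2 -> (vfun a%:E <= v%:E)%E ->
  exists2 K, 0 <= K & forall N n, (0 < N)%N -> (n <= N)%N ->
    ((B n ^+ 2)%:E * \sum_(n <= i <oo) ((P i)`_n ^+ 2)%:E
       <= (K * N.+1%:R * expR (v * N%:R))%:E)%E.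
Proof.
move=> a1 rp va; have a0 : 0 < a := lt_trans ltr01 a1.
have v0 : 0 <= v.
  rewrite -lee_fin (le_trans _ va)// vfun_series//.
  by apply: nneseries_ge0 => k _ _; rewrite lee_fin ltW// vcoef_gt0.
have gam0 : 0 < (2^-1 : R) `^ a <= 1.
  rewrite powR_gt0 ?invr_gt0//= -[leRHS](powRr0 2^-1); apply: ger_powR; last exact: ltW.
  by rewrite invr_gt0 ltr0n/= invf_le1// ler1n.
have [K K0 hK] := coef_orthopoly_le b_gt0 n2 gam0.
pose D := 1 + 2 `^ a * v.
have D0 : 0 <= D by rewrite addr_ge0// mulr_ge0 ?powR_ge0.
exists (K ^+ 2 * D) => [|N n N0 nN]; first by rewrite mulr_ge0 ?sqr_ge0.
have Np : 0 < N%:R :> R by rewrite ltr0n.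
pose h l : R := (N%:R / (N + l.*2)%:R) `^ a.
pose g l : R := ((N + l.*2).-1%:R / (N + l.*2)%:R) `^ a.
have h01 l : (0 < l)%N -> 0 <= h l < 1.
  move=> l0; have Nl : (N < N + l.*2)%N by rewrite -addn1 leq_add2l double_gt0.
  have Nl0 : 0 < (N + l.*2)%:R :> R by rewrite ltr0n (leq_ltn_trans _ Nl).
  have q01 : 0 < (N%:R / (N + l.*2)%:R : R) < 1.
    by rewrite divr_gt0//= ltr_pdivrMr// mul1r ltr_nat.
  by have /andP[_ ->] := powR_itv01 a0 q01; rewrite powR_ge0.
(* For N = 1 the value [g 0] is 0 and violates the lower bound required at every index; the products
   start at index 1. *)
pose g' l := if l == 0%N then 1 else g l.
have g'g l : g' l.+1 = g l.+1 by [].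
have gg l : 2^-1 `^ a <= g' l.
  rewrite /g'; case: eqP => [_|/eqP]; first by case/andP: gam0.
  rewrite -lt0n => l0; apply: ge0_ler_powR; rewrite ?nnegrE ?divr_ge0 ?invr_ge0 ?(ltW a0)//.
  rewrite ler_pdivlMr ?ltr0n; last by lia.
  rewrite ler_pdivrMl// -natrM ler_nat; lia.
have := hK N g' h gg h01 _ n _ nN => /(_ _)/= hC.
have {}hC j : B n * `|(P (n + j.*2))`_n| <= K * \prod_(i < j) (g i.+1 / (1 - h i.+1)).
  apply: hC => {}n i i0 {}nN nni; split => [n0|].
    apply: le_trans (rp n.-1 (n + i.*2).-1 _ _) _;
      [clear -nN nni i0; lia|clear -nN nni i0; lia|].
    rewrite !prednK//; last by lia.
    apply: ge0_ler_powR; rewrite ?nnegrE ?divr_ge0 ?(ltW a0)//.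
    rewrite ler_pdivrMr ?ltr0n; last by lia.
    rewrite mulrAC ler_pdivlMr ?ltr0n; last by lia.
    by rewrite -!natrM ler_nat; nia.
  rewrite /g' ifF; last by apply/negbTE; rewrite -lt0n.
  apply: le_trans (rp (n + i.*2).-2 (n + i.*2).-1 _ _) _;
      [clear -nN nni i0; lia|clear -nN nni i0; lia|].
  rewrite !prednK//; [|lia|lia].
  apply: ge0_ler_powR; rewrite ?nnegrE ?divr_ge0 ?(ltW a0)//.
  rewrite ler_pdivrMr ?ltr0n; last by lia.
  rewrite mulrAC ler_pdivlMr ?ltr0n; last by lia.
  by rewrite -!natrM ler_nat; nia.
(* With r = N + 2 j + 2, the inequality ((r - 1) / r)^2 <= (r - 1) / (r + 1) telescopes to [q]. *)
pose q j : R := (N.+1%:R / (N + j.*2).+1%:R) `^ a.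
have gq j : (\prod_(i < j) g i.+1) ^+ 2 <= q j.
  elim: j => [|j ih].
    by rewrite big_ord0 expr1n /q addn0 divff ?powR1// pnatr_eq0.
  rewrite big_ord_recr/= exprMn.
  have -> : q j.+1 = q j * ((N + j.*2).+1%:R / (N + j.+1.*2).+1%:R) `^ a.
    rewrite /q -powRM ?divr_ge0//; congr (_ `^ a).
    by rewrite mulrA divfK// pnatr_eq0.
  have -> : g j.+1 ^+ 2 = (((N + j.+1.*2).-1%:R / (N + j.+1.*2)%:R) ^+ 2) `^ a.
    by rewrite /g !expr2 -powRM ?divr_ge0.
  apply: ler_pM; [exact: sqr_ge0|exact: powR_ge0|exact: ih|].
  apply: ge0_ler_powR; [exact: ltW|rewrite nnegrE; exact: sqr_ge0|by rewrite nnegrE divr_ge0|].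
  have p1 : 0 < (N + j.+1.*2)%:R ^+ 2 :> R by rewrite exprn_gt0// ltr0n; clear -N0; lia.
  rewrite expr_div_n ler_pdivrMr// mulrAC ler_pdivlMr ?ltr0n//.
  by rewrite -!natrX -!natrM ler_nat; clear -N0; nia.
have sumh j : \sum_(l < j) h l.+1 <= N%:R / 2 * v.
  apply: le_trans (sum_log_le_vfun j a1 N0 va); apply: ler_sum => l _.
  have /andP[h0 h1] := h01 l.+1 isT.
  rewrite -/(h l.+1) lerNr; have := @le_ln1Dx R (- h l.+1); apply; lra.
have prodh j : \prod_(i < j) (1 - h i.+1)^-1 <= expR (N%:R / 2 * v).
  apply: le_trans (_ : expR (\sum_(l < j) - ln (1 - h l.+1)) <= _); last first.
    by rewrite ler_expR; exact: sum_log_le_vfun.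
  rewrite expR_sum le_eqVlt; apply/orP; left; apply/eqP/eq_bigr => i _.
  have /andP[h0 h1] := h01 i.+1 isT.
  by rewrite expRN lnK// posrE subr_gt0.
(* For i > 0, [q i] is at most 2^a [h i], and h <= - ln (1 - h); so the Riemann sum of v also bounds
   the sum of the decaying factors. *)
have sumq j : \sum_(i < j) q i <= D * N.+1%:R.
  have q0 i : 0 <= q i by exact: powR_ge0.
  case: j => [|j]; first by rewrite big_ord0 mulr_ge0.
  rewrite big_ord_recl /= {1}/q addn0 divff ?pnatr_eq0// powR1.
  apply: (@le_trans _ _ (1 + 2 `^ a * (N%:R / 2 * v))); last first.
    rewrite /D mulrDl mul1r lerD ?ler1n// -[leRHS]mulrA ler_wpM2l ?powR_ge0//.
    have e : N.+1%:R = N%:R + 1 :> R by rewrite natr1.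
    by rewrite mulrC ler_wpM2l// e; lra.
  rewrite lerD2l; apply: le_trans (ler_wpM2l (powR_ge0 2 a) (sumh j)).
  rewrite mulr_sumr; apply: ler_sum => i _.
  rewrite /q /h -powRM ?divr_ge0//; apply: ge0_ler_powR;
    rewrite ?nnegrE ?mulr_ge0 ?divr_ge0 ?(ltW a0)//.
  rewrite ler_pdivrMr ?ltr0n// mulrA mulrAC ler_pdivlMr ?ltr0n; last by lia.
  by rewrite /bump/= add1n -!natrM ler_nat; nia.
have B0 := prodb_gt0 b_gt0 n.
rewrite -nneseriesZl; last by move=> i _; rewrite lee_fin sqr_ge0.
apply: lime_le.
  by apply: is_cvg_nneseries => i _ _; apply: mule_ge0; rewrite lee_fin sqr_ge0.
near=> m.
have -> : (\sum_(n <= i < m) ((B n ^+ 2)%:E * ((P i)`_n ^+ 2)%:E) =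
    (\sum_(n <= i < m) (B n * (P i)`_n) ^+ 2)%R%:E)%E.
  by rewrite -sumEFin; apply: eq_bigr => i _; rewrite -EFinM exprMn.
rewrite lee_fin.
apply: le_trans (@sum_sq_even (fun i => (B n * (P i)`_n) ^+ 2) n m _ _) _.
- by move=> i; exact: sqr_ge0.
- by move=> i ni; rewrite coef_orthopoly_odd ?mulr0 ?expr0n// addnC.
apply: (@le_trans _ _ (\sum_(j < m) K ^+ 2 * expR (v * N%:R) * q j)).
  apply: ler_sum => j _; rewrite -real_normK ?num_real// normrM (gtr0_norm B0).
  have G0 : 0 <= \prod_(i < j) g i.+1 by apply: prodr_ge0 => i _; exact: powR_ge0.
  have hb : B n * `|(P (n + j.*2))`_n| <= K * (\prod_(i < j) g i.+1 * expR (N%:R / 2 * v)).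
    apply: le_trans (hC j) _; rewrite ler_wpM2l// big_split/=.
    exact: ler_wpM2l (prodh j).
  have hb0 : 0 <= B n * `|(P (n + j.*2))`_n| by rewrite mulr_ge0// ltW.
  apply: le_trans (lerXn2r 2 _ _ hb) _; rewrite ?nnegrE ?(le_trans hb0)//.
  rewrite !exprMn -expRM_natl -[leRHS]mulrA ler_wpM2l ?sqr_ge0//.
  have -> : 2%:R * (N%:R / 2 * v) = v * N%:R by field.
  by rewrite mulrC ler_wpM2l ?expR_ge0.
rewrite -mulr_sumr; apply: le_trans (ler_wpM2l _ (sumq m)) _.
  by rewrite mulr_ge0 ?sqr_ge0 ?expR_ge0.
by rewrite le_eqVlt; apply/orP; left; apply/eqP; ring.
Unshelve. all: by end_near. Qed.

End V_growth.

(** * From exponential bounds to limits superior of roots *)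

Section exponential_rates.
Variable R : realType.
Implicit Types (r s : R) (x y : \bar R).

Lemma poly_le_expR (K d : R) (n : nat) : 0 <= K -> 0 < d ->
  exists m, forall N, (m <= N)%N -> K * N.+1%:R ^+ n <= expR (d * N%:R).
Proof.
move=> K0 d0; pose c := K * 2 ^+ n * n.+1`!%:R / d ^+ n.+1.
have f0 : 0 < n.+1`!%:R :> R by rewrite ltr0n fact_gt0.
exists (Num.truncn c).+1 => N hN.
have cN : c <= N%:R by apply: le_trans (ltW (truncnS_gt c)) _; rewrite ler_nat.
have N1 : 1 <= N%:R :> R by rewrite ler1n (leq_trans _ hN).
apply: le_trans (_ : 1 + (d * N%:R) ^+ n.+1 / n.+1`!%:R <= _); last first.
  by apply: expR_ge1Dxn; rewrite mulr_ge0 ?(ltW d0).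
apply: (@le_trans _ _ ((d * N%:R) ^+ n.+1 / n.+1`!%:R)); last by rewrite lerDr.
apply: (@le_trans _ _ (K * (2 * N%:R) ^+ n)).
  rewrite ler_wpM2l// lerXn2r ?nnegrE ?mulr_ge0//.
  have -> : N.+1%:R = N%:R + 1 :> R by rewrite natr1.
  lra.
rewrite ler_pdivlMr//.
have -> : (d * N%:R) ^+ n.+1 = d ^+ n.+1 * N%:R ^+ n * N%:R.
  by rewrite exprMn [N%:R ^+ n.+1]exprSr mulrA.
have -> : K * (2 * N%:R) ^+ n * n.+1`!%:R = K * 2 ^+ n * n.+1`!%:R * N%:R ^+ n.
  by rewrite exprMn; ring.
move: cN; rewrite /c ler_pdivrMr ?exprn_gt0// => cN.
have Nn : 0 <= N%:R ^+ n :> R by rewrite exprn_ge0.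
apply: le_trans (ler_wpM2r Nn cN) _.
by rewrite le_eqVlt; apply/orP; left; apply/eqP; ring.
Qed.

Lemma limn_esup_le (u : nat -> \bar R) x n :
  (forall k, (n <= k)%N -> (u k <= x)%E) -> (limn_esup u <= x)%E.
Proof.
move=> h; rewrite limn_esup_lim; apply: lime_le; first exact: is_cvg_esups.
near=> m; apply: ge_ereal_sup => _ [k /= mk <-]; apply: h.
by apply: leq_trans mk; near: m; exact: nbhs_infty_ge.
Unshelve. all: by end_near. Qed.

Lemma limn_esup_le_expeR (u : nat -> \bar R) x : (0 <= x)%E ->
  (forall r, (x < r%:E)%E -> exists n, forall k, (n <= k)%N -> (u k <= (expR r)%:E)%E) ->
  (limn_esup u <= expeR x)%E.
Proof.
move=> x0 h; case: x x0 h => [x| |] x0 h; [|by rewrite leey|by []].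
have {}h r : x < r -> (limn_esup u <= (expR r)%:E)%E.
  by rewrite -lte_fin => /h[n]; exact: limn_esup_le.
rewrite leNgt; apply/negP => /=; case: (limn_esup u) h => [l| |] h //.
  rewrite lte_fin => xl; have l0 : 0 < l := lt_trans (expR_gt0 x) xl.
  have xl' : x < ln l by rewrite -ltr_expR lnK.
  have := h ((x + ln l) / 2); rewrite lee_fin -[leLHS]lnK// ler_expR => /(_ _) h'.
  by have := h' (_ : x < _); lra.
by move=> _; have := h (x + 1); rewrite ltrDl ltr01 => /(_ isT); rewrite leye_eq.
Qed.

Lemma root_le_expR (y r : R) N : 0 <= y -> (0 < N)%N -> y <= expR (r * N%:R) ->
  y `^ N%:R^-1 <= expR r.
Proof.
move=> y0 N0 h; apply: le_trans (ge0_ler_powR _ _ _ h) _; rewrite ?nnegrE ?expR_ge0 ?invr_ge0//.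
by rewrite -expRM mulfK// pnatr_eq0 -lt0n.
Qed.

Lemma poweR_root_le_expR (y : \bar R) r N : (0 <= y)%E -> (0 < N)%N ->
  (y <= (expR (r * N%:R))%:E)%E -> (y `^ N%:R^-1 <= (expR r)%:E)%E.
Proof.
move=> y0 N0; case: y y0 => [y| |] // y0.


by rewrite poweR_EFin !lee_fin; exact: root_le_expR.
Qed.

End exponential_rates.

(** * Passage to alpha and convergence of the series *)

Section growth_rates.
Variables (R : realType) (b f : nat -> R) (n0 : nat).
Variables (mu : probability (measurableTypeR R) R) (alpha : \bar R).
Hypothesis b_gt0 : forall n, 0 < b n.
Hypothesis mu_orth : is_orthonormal_for b mu.
Hypothesis n0_gt0 : (0 < n0)%N.
Hypothesis b_ratio : forall n, (n0 <= n)%N -> b n.-1 / b n <= expR (- f n).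
Hypothesis alphaE : alpha = limn_einf (fun n => (n%:R * f n)%:E).

Local Notation B n := (\prod_(i < n) b i).

Lemma ratio_pow_lt a : 0 <= a -> (a%:E < alpha)%E -> exists n2, ratio_pow b a n2.
Proof.
by rewrite alphaE => a0 aa; exact: (ratio_pow_ex b_gt0 n0_gt0 b_ratio a0 aa).
Qed.

Lemma Useq_le_expR_of a u r : 0 < a -> (a%:E < alpha)%E -> (ufun a%:E <= u%:E)%E ->
  2 * u < r ->
  exists n, forall N, (n <= N)%N -> Useq b mu N <= expR (r * N%:R).
Proof.
move=> a0 aalpha ua ur; have [n2 rp] := ratio_pow_lt (ltW a0) aalpha.
have [K K0 hK] := Useq_growth b_gt0 mu_orth a0 rp ua.
have d0 : 0 < r - 2 * u by rewrite subr_gt0.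
have [m hm] := poly_le_expR 3 K0 d0; exists m => N mN.
apply: le_trans (hK N) _.
have -> : expR (r * N%:R) = expR ((r - 2 * u) * N%:R) * expR (2 * u * N%:R).
  by rewrite -expRD -mulrDl subrK.
by rewrite ler_wpM2r ?expR_ge0// hm.
Qed.

Lemma Useq_le_expR r : (2%:E * ufun alpha < r%:E)%E ->
  exists n, forall N, (n <= N)%N -> Useq b mu N <= expR (r * N%:R).
Proof.
case E : alpha => [a| |]; last by rewrite /= gt0_muley ?lte_fin// ltNge leey.
  have [a0|a0] := ltP 0 a; last first.
    have -> : ufun a%:E = +oo%E by rewrite /ufun ltNge a0.
    by rewrite gt0_muley ?lte_fin// ltNge leey.
  have := ufun_ge0 a0; case U : (ufun a%:E) => [u| |]//; last first.
    by rewrite gt0_muley ?lte_fin// ltNge leey.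
  rewrite lee_fin -EFinM lte_fin => u0 ur.
  (* Lowering the exponent by the factor 1 + e costs ln (1 + e) + e <= 2 e in u, hence 4 e in 2 u:
     half of the slack. *)
  pose e := (r - 2 * u) / 8; have e0 : 0 < e by rewrite /e; lra.
  have e1 : 0 < 1 + e by rewrite addr_gt0.
  have a'0 : 0 < a / (1 + e) by rewrite divr_gt0.
  have a'a : a / (1 + e) < a by rewrite ltr_pdivrMr// ltr_pMr// ltrDl.
  have rE : a / (a / (1 + e)) = 1 + e by field; rewrite !gt_eqF.
  apply: (@Useq_le_expR_of (a / (1 + e)) (u + 2 * e)) => //.
  - by rewrite E lte_fin.
  - apply: le_trans (ufun_left a'0 (ltW a'a)) _; rewrite U rE -EFinD lee_fin lerD2l.
    have := @le_ln1Dx R e; rewrite (lt_trans (ltrN10 _) e0) => /(_ isT); lra.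
  - by rewrite /e; lra.
rewrite /= mule0 lte_fin => r0.
(* Large enough for 2 / a < r, to be used with u(a) <= 1 / a. *)
pose a := 1 + 4 / r; have a1 : 1 <= a by rewrite lerDl divr_ge0 ?ltW.
apply: (@Useq_le_expR_of a a^-1).
- by rewrite (lt_le_trans ltr01).
- by rewrite E ltry.
- exact: ufun_le_inv.
- have ap : 0 < a by rewrite (lt_le_trans ltr01).
  rewrite ltr_pdivrMr// /a mulrDr mulr1 mulrC divfK ?gt_eqF//; lra.
Qed.

Lemma ccoef_le n C : 0 <= C ->
  ((B n ^+ 2)%:E * \sum_(n <= i <oo) (((orthopoly b i)`_n) ^+ 2)%:E <= (C ^+ 2)%:E)%E ->
  ((B n)%:E * ccoef b n <= C%:E)%E.
Proof.
move=> C0; rewrite /ccoef; have B0 := prodb_gt0 b_gt0 n.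
have B20 : (0 <= (B n ^+ 2)%:E)%E by rewrite lee_fin sqr_ge0.
move=> h; have -> : (B n)%:E = sqrte (B n ^+ 2)%:E by rewrite /= sqrtr_sqr gtr0_norm.
rewrite -sqrteM//; have -> : C%:E = sqrte (C ^+ 2)%:E by rewrite /= sqrtr_sqr ger0_norm.
by rewrite lee_sqrt// lee_fin sqr_ge0.
Qed.

Lemma Vseq_le_expR_of a v r : 1 < a -> (a%:E < alpha)%E -> (vfun a%:E <= v%:E)%E ->
  v < 2 * r ->
  exists n, forall N, (n <= N)%N -> (Vseq b N <= (expR (r * N%:R))%:E)%E.
Proof.
move=> a1 aalpha va vr; have [n2 rp] := ratio_pow_lt (ltW (lt_trans ltr01 a1)) aalpha.
have [K K0 hK] := ccoef_growth b_gt0 a1 rp va.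
have d0 : 0 < 2 * r - v by rewrite subr_gt0.
have [m hm] := poly_le_expR 1 K0 d0; exists m.+1 => N mN.
apply: ccoef_le; first exact: expR_ge0.
apply: le_trans (hK N N (leq_ltn_trans (leq0n _) mN) (leqnn _)) _; rewrite lee_fin.
have -> : expR (r * N%:R) ^+ 2 = expR ((2 * r - v) * N%:R) * expR (v * N%:R).
  by rewrite -expRD -mulrDl subrK -expRM_natl mulrA.
by rewrite ler_wpM2r ?expR_ge0// (le_trans _ (hm N (ltnW mN)))// expr1.
Qed.

Lemma Vseq_le_expR r : (vfun alpha * (2^-1)%:E < r%:E)%E ->
  exists n, forall N, (n <= N)%N -> (Vseq b N <= (expR (r * N%:R))%:E)%E.
Proof.
have h2 : (0 < (2^-1)%:E :> \bar R)%E by rewrite lte_fin.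
case E : alpha => [a| |]; last by rewrite /= gt0_mulye// ltNge leey.
  have [a1|a1] := ltP 1 a; last first.
    have -> : vfun a%:E = +oo%E by rewrite /vfun ltNge a1.
    by rewrite gt0_mulye// ltNge leey.
  have v_ge0 : (0 <= vfun a%:E)%E.
    by rewrite vfun_series// nneseries_ge0// => k _ _; rewrite lee_fin ltW// vcoef_gt0.
  case V : (vfun a%:E) v_ge0 => [v| |]//; last by rewrite gt0_mulye// ltNge leey.
  rewrite lee_fin -EFinM lte_fin => v0 vr.
  (* Then e v <= e (1 + v) = (2 r - v) / 2, so (1 + e) v < 2 r. The exponent [a'] is chosen to make
     the ratio (a - 1) / (a' - 1) equal to 1 + e. *)
  pose e := (2 * r - v) / (2 * (1 + v)).
  have v1 : 0 < 2 * (1 + v) by lra.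
  have e0 : 0 < e by rewrite divr_gt0//; lra.
  have e1 : 0 < 1 + e by rewrite addr_gt0.
  pose a' := 1 + (a - 1) / (1 + e).
  have am : 0 < a - 1 by rewrite subr_gt0.
  have a'1 : 1 < a' by rewrite ltrDl divr_gt0.
  have a'a : a' < a.
    by rewrite /a' -ltrBrDl ltr_pdivrMr// ltr_pMr// ltrDl.
  have rE : (a - 1) / (a' - 1) = 1 + e.
    by rewrite /a' addrAC subrr add0r; field; rewrite !gt_eqF.
  apply: (@Vseq_le_expR_of a' ((1 + e) * v)) => //.
  - by rewrite E lte_fin.
  - by apply: le_trans (vfun_ratio a'1 (ltW a'a)) _; rewrite V rE -EFinM.
  - have ev : e * (2 * (1 + v)) = 2 * r - v by rewrite /e divfK// gt_eqF.
    by nra.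
rewrite /= mul0e lte_fin => r0.
(* Makes the bound 2 / (a - 1), the tail bound with no terms split off, equal to r. *)
pose a := 1 + 2 / r; have a1 : 1 < a by rewrite ltrDl divr_gt0.
apply: (@Vseq_le_expR_of a r) => //; [by rewrite E ltry| |lra].
apply: le_trans (vfun_le_tail 0 a1) _.
rewrite big_ord0 add0r lee_fin mulr1 /a addrAC subrr add0r.
by rewrite invf_div mulrC divfK.
Qed.

Lemma limn_esup_Useq :
  (limn_esup (fun n => (Useq b mu n `^ n%:R^-1)%:E) <= expeR (2%:E * ufun alpha))%E.
Proof.
apply: limn_esup_le_expeR => [|r /Useq_le_expR[n hn]].
  apply: mule_ge0 => //.
  case: (alpha) => [a| |]//=; have [a0|a0] := ltP 0 a; last by rewrite leey.
  by have := ufun_ge0 a0; rewrite /ufun a0.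
exists n.+1 => k nk; rewrite lee_fin; apply: root_le_expR.
- exact: Useq_ge0.
- exact: leq_ltn_trans nk.
- exact: hn (ltnW nk).
Qed.

Lemma Vseq_ge0 n : (0 <= Vseq b n)%E.
Proof. by rewrite mule_ge0 ?sqrte_ge0// lee_fin ltW// prodb_gt0. Qed.

Lemma limn_esup_Vseq : (1 <= alpha)%E ->
  (limn_esup (fun n => Vseq b n `^ n%:R^-1) <= expeR (vfun alpha * (2^-1)%:E))%E.
Proof.
move=> alpha1; apply: limn_esup_le_expeR => [|r /Vseq_le_expR[n hn]].
  apply: mule_ge0 => //.
  case: (alpha) => [a| |]//=; have [a1|a1] := ltP 1 a; last by rewrite leey.
  have : (0 <= vfun a%:E)%E.
    by rewrite vfun_series// nneseries_ge0// => k _ _; rewrite lee_fin ltW// vcoef_gt0.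
  by rewrite /vfun a1.
exists n.+1 => k nk; apply: poweR_root_le_expR.
- exact: Vseq_ge0.
- exact: leq_ltn_trans nk.
- exact: hn (ltnW nk).
Qed.

Lemma ccoef_lty n : (1 < alpha)%E -> (ccoef b n < +oo)%E.
Proof.
move=> /EFin_lt_between[a a1 aalpha].
have [n2 rp] := ratio_pow_lt (ltW (lt_trans ltr01 a1)) aalpha.
have [K K0 hK] := ccoef_growth b_gt0 a1 rp (vfun_le_tail 0 a1).
have := hK (maxn n 1) n; rewrite leq_maxl leq_max orbT => /(_ isT isT).
set X := (X in (_ <= X%:E)%E) => h.
have X0 : 0 <= X by rewrite mulr_ge0 ?expR_ge0// mulr_ge0.
have X1 : 0 <= 1 + X by rewrite addr_ge0.
(* Since X <= (1 + X)^2, the bound 1 + X avoids a square root. *)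
have : ((B n)%:E * ccoef b n <= (1 + X)%:E)%E.
  apply: ccoef_le => //; apply: le_trans h _; rewrite lee_fin; nra.
have B0 := prodb_gt0 b_gt0 n.
have : (0 <= ccoef b n)%E by exact: sqrte_ge0.
by case: (ccoef b n) => [c| |]// _; rewrite ?ltry// gt0_muley ?lte_fin// leye_eq.
Qed.

Lemma sum_geometric_lty (F : nat -> R) (C x : R) l0 :
  (forall l, 0 <= F l) -> 0 <= C -> 0 <= x < 1 ->
  (forall l, (l0 <= l)%N -> F l <= C * x ^+ l) ->
  (\sum_(0 <= l <oo) (F l)%:E < +oo)%E.
Proof.
move=> F0 C0 /andP[x0 x1] hF.
have x10 : 0 < 1 - x by rewrite subr_gt0.
have geo n : \sum_(l < n) x ^+ l <= (1 - x)^-1.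
  rewrite -[leRHS]mul1r ler_pdivlMr// mulrC -opprB mulNr -subrX1 opprB.
  by rewrite lerBlDr lerDl exprn_ge0.
have G n : \sum_(l < n) F l <= \sum_(l < l0) F l + C * \sum_(l < n) x ^+ l.
  have S0 k : 0 <= C * \sum_(l < k) x ^+ l.
    by rewrite mulr_ge0// sumr_ge0// => l _; rewrite exprn_ge0.
  have [nl0|l0n] := leqP n l0.
    apply: (@le_trans _ _ (\sum_(l < l0) F l)); last by rewrite lerDl.
    rewrite -(subnKC nl0) big_split_ord/= lerDl sumr_ge0//.
  rewrite -(subnKC (ltnW l0n)); elim: (n - l0)%N => [|k ih].
    by rewrite addn0 lerDl.
  rewrite addnS !big_ord_recr/= mulrDr addrA lerD//.
  by apply: hF; rewrite leq_addr.
apply: (@le_lt_trans _ _ (\sum_(l < l0) F l + C / (1 - x))%:E); last exact: ltry.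
apply: lime_le; first by apply: is_cvg_nneseries => l _ _; rewrite lee_fin.
near=> n; rewrite sumEFin big_mkord lee_fin; apply: le_trans (G n) _.
by rewrite lerD2l ler_wpM2l.
Unshelve. all: by end_near. Qed.

Lemma property_cs_star_of a ru rv : 0 < a -> (a%:E < alpha)%E ->
  (exists n, forall N, (n <= N)%N -> Useq b mu N <= expR (ru * N%:R)) ->
  (exists n, forall N, (n <= N)%N -> (Vseq b N <= (expR (rv * N%:R))%:E)%E) ->
  (forall n, (ccoef b n < +oo)%E) ->
  ru + 2 * rv < a * ln 4 ->
  property_cs_star b mu.
Proof.
move=> a0 aalpha [nU hU] [nV hV] cfin hr m.
have [n2 rp] := ratio_pow_lt (ltW a0) aalpha.
pose c l := fine (ccoef b l).
have cE l : ccoef b l = (c l)%:E.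
  by rewrite /c fineK// ge0_fin_numE ?cfin ?sqrte_ge0.
have c0 l : 0 <= c l by rewrite fine_ge0 ?sqrte_ge0.
under eq_eseriesr do rewrite cE -EFinM.
(* A quarter of the slack. Up to constants the term with l + m = 2 p is at most exp (p (ru + 2 rv +
   eta)) = exp (- 2 d p), which is exp (- d l) times a factor depending on m only. *)
pose d := (a * ln 4 - (ru + 2 * rv)) / 4.
have d0 : 0 < d by rewrite divr_gt0// subr_gt0.
pose e := d / a; have e0 : 0 < e by rewrite divr_gt0.
pose eta := 2 * d - a * ln 4.
(* From [p1] on all eventual bounds hold, and e p >= m + 1. The latter gives (p + 1) / (k + 1) <= (1
   + e) / 2 for k >= 2 p - m. *)
pose p1 := (m + n2 + nU + nV + (Num.truncn (m.+1%:R / e)).+1)%N.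
(* For l + m = 2 p, the term c_l s_(2p) is V_l U_p [Q p]. *)
pose Q p := B p ^+ 2 / B (p.*2 - m).
have B0 := prodb_gt0 b_gt0.
have Q0 p : 0 <= Q p by rewrite divr_ge0 ?sqr_ge0// ltW.
have half p k : (p1 <= p)%N -> (p.*2 - m <= k)%N -> b p / b k <= expR (eta / 2).
  move=> p1p pk.
  have mp : (m + n2 <= p)%N by rewrite (leq_trans _ p1p)// /p1 -!addnA leq_add2l leq_addr.
  apply: le_trans (rp p k _ _) _; [lia|lia|].
  have -> : eta / 2 = (e - ln 2) * a.
    have ln4 : ln 4 = 2 * ln 2 :> R.
      by rewrite (_ : 4 = 2 ^+ 2 :> R) ?lnXn ?mulr_natl//; lra.
    by rewrite /eta /e [RHS]mulrBl divfK ?gt_eqF// ln4; field.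
  rewrite expRM; apply: ge0_ler_powR; rewrite ?nnegrE ?divr_ge0 ?expR_ge0 ?(ltW a0)//.
  rewrite expRB lnK ?posrE// ler_pdivlMr// mulrAC ler_pdivrMr ?ltr0n//.
  apply: le_trans (ler_wpM2r _ (expR_ge1Dx e)); last by rewrite ler0n.
  have pe : m.+1%:R <= e * p%:R.
    rewrite mulrC -ler_pdivrMr//; apply: le_trans (ltW (truncnS_gt _)) _.
    by rewrite ler_nat (leq_trans _ p1p)// /p1 leq_addl.
  have kp : p%:R <= k.+1%:R :> R by rewrite ler_nat; lia.
  have kp2 : p.+1%:R * 2 <= k.+1%:R + m.+1%:R :> R by rewrite -natrM -natrD ler_nat; lia.
  by have := ler_wpM2l (ltW e0) kp; move: pe kp2; rewrite mulrDl mul1r; lra.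
(* Passing to p + 1 multiplies by b_p^2 / (b_(2p-m) b_(2p-m+1)), two ratios of size about 2^(-
   a). *)
have Qstep p : (p1 <= p)%N -> Q p.+1 <= Q p * expR eta.
  move=> p1p; have mp : (m <= p)%N by rewrite (leq_trans _ p1p)// /p1 -!addnA leq_addr.
  have -> : Q p.+1 = Q p * ((b p / b (p.*2 - m)) * (b p / b (p.*2 - m).+1)).
    rewrite /Q doubleS !subSn ?leqW//; [|lia|lia].
    rewrite !prodbS; field; rewrite !gt_eqF//.
  rewrite ler_wpM2l// (_ : expR eta = expR (eta / 2) * expR (eta / 2)); last first.
    by rewrite -expRD -splitr.
  by apply: ler_pM; rewrite ?divr_ge0 ?(ltW (b_gt0 _))// half.
have Qp k : Q (p1 + k)%N <= Q p1 * expR (eta * k%:R).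
  elim: k => [|k ih]; first by rewrite addn0 mulr0 expR0 mulr1.
  rewrite addnS; apply: le_trans (Qstep _ (leq_addr _ _)) _.
  have -> : eta * k.+1%:R = eta * k%:R + eta by rewrite -natr1 mulrDr mulr1.
  by rewrite (expRD (eta * k%:R) eta) [leRHS]mulrA ler_wpM2r ?expR_ge0.
apply: (@sum_geometric_lty _ (Q p1 * expR (- eta * p1%:R - (rv + d) * m%:R)) (expR (- d)) p1.*2).
- by move=> l; rewrite mulr_ge0.
- by rewrite mulr_ge0 ?expR_ge0.
- by rewrite expR_ge0 expR_lt1 oppr_lt0.
move=> l pl.
have rhs0 : 0 <= Q p1 * expR (- eta * p1%:R - (rv + d) * m%:R) * expR (- d) ^+ l.
  by rewrite mulr_ge0 ?exprn_ge0 ?expR_ge0// mulr_ge0 ?expR_ge0.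
have [olm|elm] := boolP (odd (l + m)).
  have -> : (l + m = (l + m)./2.*2.+1)%N by rewrite -[LHS]odd_double_half olm.
  by rewrite (moment_odd b_gt0 mu_orth) normr0 mulr0.
pose k := ((l + m)./2 - p1)%N.
have lmE : (l + m = (p1 + k).*2)%N.
  have e2 : (l + m = (l + m)./2.*2)%N by rewrite even_halfK.
  by rewrite /k subnKC//; lia.
set p := (p1 + k)%N in lmE.
have lE : l = (p.*2 - m)%N by rewrite -lmE addnK.
rewrite lmE (momentE mu b_gt0) normrM ger0_norm ?sqr_ge0// ger0_norm ?Useq_ge0//.
have pU : Useq b mu p <= expR (ru * p%:R).
  by apply: hU; rewrite /p /p1; lia.
have lV : B l * c l <= expR (rv * l%:R).
  rewrite -lee_fin EFinM -cE; apply: hV; move: pl; rewrite /p1; lia.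
apply: (@le_trans _ _ (expR (rv * l%:R) * expR (ru * p%:R) * Q p)).
  have -> : c l * (B p ^+ 2 * Useq b mu p) = (B l * c l) * Useq b mu p * Q p.
    by rewrite /Q -lE; field; rewrite gt_eqF.
  rewrite ler_wpM2r//; apply: ler_pM => //; last exact: Useq_ge0.
  by rewrite mulr_ge0// ltW.
apply: (@le_trans _ _ (expR (rv * l%:R) * expR (ru * p%:R) * (Q p1 * expR (eta * k%:R)))).
  by rewrite ler_wpM2l ?Qp// mulr_ge0 ?expR_ge0.
have -> : expR (rv * l%:R) * expR (ru * p%:R) * (Q p1 * expR (eta * k%:R)) =
    Q p1 * expR (rv * l%:R + ru * p%:R + eta * k%:R).
  by rewrite (expRD (rv * l%:R + ru * p%:R)) (expRD (rv * l%:R)) mulrCA.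
rewrite -[X in _ <= X]mulrA ler_wpM2l// -expRM_natl -expRD ler_expR le_eqVlt.
apply/orP; left; apply/eqP.
have lR : l%:R = 2 * p%:R - m%:R :> R.
  by rewrite -[l%:R](addrK m%:R) -natrD lmE -muln2 natrM mulrC.
have pR : k%:R = p%:R - p1%:R :> R by rewrite /p natrD addrAC subrr add0r.
have etaE : ru = - 4 * d - 2 * rv + (2 * d - eta) by rewrite /eta /d; field.
rewrite lR pR etaE; ring.
Qed.

Lemma property_cs_star_kfun : (1 < alpha)%E -> (kfun alpha < 1)%E -> property_cs_star b mu.
Proof.
move=> alpha1 kalpha; have cfin n := ccoef_lty n alpha1.
have ln4 : 0 < ln 4 :> R by rewrite ln_gt0// ltr1n.
have [a [ru [rv [a0 aalpha hu [hv hr]]]]] : exists a ru rv,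
    [/\ 0 < a, (a%:E < alpha)%E, (2%:E * ufun alpha < ru%:E)%E &
     (vfun alpha * (2^-1)%:E < rv%:E)%E /\ ru + 2 * rv < a * ln 4].
  move: alpha1 kalpha; case: alpha => [c| |]//.
    rewrite lte_fin => c1.
    have c0 := lt_trans ltr01 c1.
    have u0 := ufun_ge0 c0.
    have v0 : (0 <= vfun c%:E)%E.
      by rewrite vfun_series// nneseries_ge0// => k _ _; rewrite lee_fin ltW// vcoef_gt0.
    have c4 : (0 < (4 `^ (- c))%:E)%E by rewrite lte_fin powR_gt0.
    rewrite /kfun; case U : (ufun c%:E) u0 => [u| |]// u0; last first.
      by rewrite gt0_muley ?lte_fin// addye; [rewrite /= gt0_muley|case: (vfun _) v0].
    case V : (vfun c%:E) v0 => [v| |]// v0; last first.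
      by rewrite addey ?lte_fin//= gt0_muley.
    move=> h0; have : 4 `^ (- c) * expR (2 * u + v) < 1 by rewrite -lte_fin EFinM.
    rewrite /powR gt_eqF// -expRD expR_lt1 => h.
    have {}h : 2 * u + v < c * ln 4 by move: h; rewrite mulNr; lra.
    (* Of the slack 8 g, lowering the exponent takes 2 g and the rates ru and 2 rv take 3 g. *)
    pose g := (c * ln 4 - (2 * u + v)) / 8.
    have g0 : 0 < g by rewrite /g; lra.
    have gE : c * ln 4 = 2 * u + v + 8 * g by rewrite /g; field.
    have uv0 : 0 <= 2 * u + v by move: u0 v0; rewrite !lee_fin; lra.
    exists (c - 2 * g / ln 4), (2 * u + g), (v / 2 + g); rewrite -!EFinM !lte_fin.
    have ag : 2 * g / ln 4 < c by rewrite ltr_pdivrMr//; lra.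
    have ag0 : 0 < 2 * g / ln 4 by rewrite divr_gt0// mulr_gt0.
    have agE : (c - 2 * g / ln 4) * ln 4 = c * ln 4 - 2 * g.
      by rewrite mulrBl divfK// gt_eqF.
    by split; [lra|lra|lra|split; [lra|rewrite agE; lra]].
  (* As u and v vanish at infinity, all positive rates are available; with exponent 1 these take up
     half of ln 4. *)
  move=> _ _; exists 1, (ln 4 / 4), (ln 4 / 8); rewrite /= mule0 mul0e !lte_fin ltry.
  by split => //; [lra|split; lra].
exact: (property_cs_star_of a0 aalpha (Useq_le_expR hu) (Vseq_le_expR hv) cfin hr).
Qed.

End growth_rates.

Theorem theorem1p10 (R : realType) (b : nat -> R) (f : nat -> R) (n0 : nat)
  (mu : probability (measurableTypeR R) R) (alpha : \bar R)
  (b_gt0 : forall n, 0 < b n)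
  (mu_orth : is_orthonormal_for b mu)
  (n0_gt0 : (0 < n0)%N)
  (f_gt0 : forall n, (n0 <= n)%N -> 0 < f n)
  (b_ratio : forall n, (n0 <= n)%N -> b n.-1 / b n <= expR (- f n))
  (alphaE : alpha = limn_einf (fun n => (n%:R * f n)%:E)) :
  (limn_esup (fun n => (Useq b mu n `^ n%:R^-1)%:E)
     <= expeR (2%:E * ufun alpha))%E
  /\ ((1 <= alpha)%E ->
      (limn_esup (fun n => Vseq b n `^ n%:R^-1)
         <= expeR (vfun alpha * (2^-1)%:E))%E)
  /\ ((1 < alpha)%E -> (kfun alpha < 1)%E -> property_cs_star b mu)
  (* 1687 / 10^3 + 46 / 10^5 = 1.68746 *)
  /\ (((1687%:R / 10%:R ^+ 3 + 46%:R / 10%:R ^+ 5)%:E <= alpha)%E -> (kfun alpha < 1)%E).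
Proof.
split; first exact: (limn_esup_Useq b_gt0 mu_orth n0_gt0 b_ratio alphaE).
split; first exact: (limn_esup_Vseq b_gt0 n0_gt0 b_ratio alphaE).
split; first exact: (property_cs_star_kfun b_gt0 mu_orth n0_gt0 b_ratio alphaE).
case: (alpha) => [a| |]//; last by move=> _; rewrite lte_fin ltr01.
by rewrite lee_fin; exact: kfun_lt1.
Qed.
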